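(* Let $k_0\in\mathbb{N}$ be fixed. There is $L_0>0$ such that the following holds. For every finite set $\{U_n\}$ with $0<U_1<U_2<\dots<U_{n_0}<\frac{\pi}{4}$, $n_0\in\mathbb{N}$, there are elements $$w_1^n=w_1(U_n,\pi L,k_1,f_1,\sigma_0^1-\delta,\sigma_0^1+\delta)\in S^1_{\sigma_0^1,\delta},\qquad w_2^n=w_2(U_n,\pi L,k_2,f_2,\sigma_0^2-\delta,\sigma_0^2+\delta)\in S^2_{\sigma_0^2,\delta},$$ $n=1,\dots,n_0$ (each depending only on the indicated parameters), such that for all $L\in\mathbb{N}$ with $L\ge L_0$, all $1\le k_1,k_2\le k_0$ and all $n=1,\dots,n_0$, $$\left\{\prod_{r=1}^{k_1}\frac{\tilde Z^2(\alpha_r^{1,k_1,n})}{\tilde Z^2(\beta_r^{k_1,n})}\right\}|\zeta(w_1^n)|+\left\{\prod_{r=1}^{k_2}\frac{\tilde Z^2(\alpha_r^{2,k_2,n})}{\tilde Z^2(\beta_r^{k_2,n})}\right\}|\zeta(w_2^n)|=1.$$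
   Context: $\zeta$ is the Riemann zeta-function. Jacob's ladder. Fix a smooth, increasing, unbounded function $\mu$ with $\mu(y)\ge 7y\ln y$ for large $y$, and put $\Phi(y)=\int_0^{\mu(y)}|\zeta(\frac12+it)|^2e^{-2t/y}\,dt$. For large $T$ let $\varphi(T)$ be the solution of $\Phi(\varphi(T))=\int_0^T|\zeta(\frac12+it)|^2dt$, and let $\varphi_1(T)=\frac12\varphi(T)$. The function $\mu$ is taken admissible, so that for large $t$ the function $\varphi_1$ is $C^1$, strictly increasing and unbounded, and $$\tilde Z^2(t):=\frac{d\varphi_1(t)}{dt}=\frac{|\zeta(\frac12+it)|^2}{\omega(t)},\qquad \omega(t)=2\Phi'(\varphi(t))=\left\{1+O\left(\frac{\ln\ln t}{\ln t}\right)\right\}\ln t .$$ Iterates: $\varphi_1^0(t)=t$, $\varphi_1^{r+1}=\varphi_1\circ\varphi_1^{r}$. Reverse iterates: for large $T$, $T^{[0]}=T$ and $T^{[r]}$ is defined by $\varphi_1(T^{[r]})=T^{[r-1]}$. The points $\alpha,\beta$. Let $f_1(t)=\sin^2t$, $f_2(t)=\cos^2t$. For $U\in(0,\pi/4)$, $L\in\mathbb{N}$ large, $1\le k\le k_0$, put $I=((\pi L)^{[k]},(\pi L+U)^{[k]})$. For $j=1,2$ let $d_j=d_j(U,\pi L,k)\in I$ be a (fixed) mean-value point: $F_j(d_j)=\frac1{|I|}\int_I F_j(t)\,dt$ with $F_j(t)=f_j(\varphi_1^k(t))\prod_{r=0}^{k-1}\tilde Z^2(\varphi_1^r(t))$;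 let $e=e(U,\pi L,k)\in I$ be a (fixed) mean-value point of $F_0(t)=\prod_{r=0}^{k-1}\tilde Z^2(\varphi_1^r(t))$ on $I$ in the same sense. Set $\alpha_r^{j,k}=\alpha_r(U,\pi L,k;f_j)=\varphi_1^{k-r}(d_j)$ for $r=0,1,\dots,k$ and $\beta_r^{k}=\beta_r(U,\pi L,k)=\varphi_1^{k-r}(e)$ for $r=1,\dots,k$. Thus $\alpha_0^{j,k}\in(\pi L,\pi L+U)$ and $\alpha_r^{j,k},\beta_r^k\in((\pi L)^{[r]},(\pi L+U)^{[r]})$ for $1\le r\le k$. For $U=U_n$ write $\alpha_r^{j,k,n}=\alpha_r(U_n,\pi L,k;f_j)$, $\beta_r^{k,n}=\beta_r(U_n,\pi L,k)$. Strips. Fix $\frac12<\sigma_1<\sigma_0^1<\sigma_0^2<\sigma_0^3<\sigma_2<1$ and a sufficiently small $\delta>0$ with $\sigma_1<\sigma_0^1-\delta$, $\sigma_0^3+\delta<\sigma_2$, $\sigma_0^1+\delta<\sigma_0^2-\delta$, $\sigma_0^2+\delta<\sigma_0^3-\delta$. Put $S^l_{\sigma_0^l,\delta}=\{\sigma+it:\ \sigma_0^l-\delta<\sigma<\sigma_0^l+\delta,\ t>0\}$, $l=1,2$. *)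

(* Defs.v *)
From Stdlib Require Import Reals Lra Lia List.
From Coquelicot Require Import Coquelicot.
Open Scope R_scope.

(* x^z for real x > 0 and complex z. *)
Definition Rcpow (x : R) (z : C) : C :=
  (Rpower x (Re z) * cos (Im z * ln x), Rpower x (Re z) * sin (Im z * ln x)).

Definition zeta_approx (s : C) (N : nat) : C :=
  (sum_n_m (fun n : nat => Rcpow (INR n) (Copp s)) 1 N
   - Rcpow (INR N) (1 - s) / (1 - s))%C.

(* The Riemann zeta-function on Re s > 0, s <> 1.  By Euler-Maclaurin,
     sum_{n <= N} n^(-s) - N^(1-s)/(1-s)
        = s/(s-1) - s * int_1^N {x} x^(-s-1) dx,
   whose limit as N -> oo is the classical analytic continuation
   of sum n^(-s) to the half-plane Re s > 0.  For Re s > 1 the subtracted term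
   tends to 0 (lemma zeta_dirichlet).  The value elsewhere is not meaningful. *)
Definition zeta (s : C) : C :=
  (real (Lim_seq (fun N => Re (zeta_approx s N))),
   real (Lim_seq (fun N => Im (zeta_approx s N)))).

Definition zeta_crit_sq (t : R) : R := (Cmod (zeta (1 / 2, t))) ^ 2.

(* mu is a function on (y0, +oo); its values elsewhere are never used. *)
Definition ladder_parameter (mu : R -> R) (y0 : R) : Prop :=
  0 <= y0 /\
  (forall (n : nat) (y : R), y0 < y -> ex_derive_n mu n y) /\
  (forall y y' : R, y0 < y -> y <= y' -> mu y <= mu y') /\
  (forall M : R, exists y : R, y0 < y /\ M < mu y) /\
  (exists y1 : R, forall y : R, y0 < y -> y1 < y -> 7 * y * ln y <= mu y).

Definition Phi (mu : R -> R) (y : R) : R :=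
  RInt (fun t => zeta_crit_sq t * exp (- 2 * t / y)) 0 (mu y).

(* The solution exists and is unique for all large T. *)
Definition phi (mu : R -> R) (y0 T : R) : R :=
  iota (fun y : R => y0 < y /\ Phi mu y = RInt zeta_crit_sq 0 T).

Definition phi1 (mu : R -> R) (y0 T : R) : R := / 2 * phi mu y0 T.

Definition omega (mu : R -> R) (y0 t : R) : R :=
  2 * Derive (Phi mu) (phi mu y0 t).

Definition Ztilde2 (mu : R -> R) (y0 t : R) : R := Derive (phi1 mu y0) t.

(* T0 is a threshold beyond which the "large t" properties hold. *)
Definition admissible (mu : R -> R) (y0 T0 : R) : Prop :=
  (forall t : R, T0 < t -> ex_derive (phi1 mu y0) t) /\
  (forall t : R, T0 < t -> continuous (Derive (phi1 mu y0)) t) /\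
  (forall t t' : R, T0 < t -> t < t' -> phi1 mu y0 t < phi1 mu y0 t') /\
  (forall M : R, exists t : R, T0 < t /\ M < phi1 mu y0 t) /\
  (forall t : R, T0 < t -> Ztilde2 mu y0 t = zeta_crit_sq t / omega mu y0 t) /\
  (exists A T1 : R, forall t : R, T1 < t ->
     Rabs (omega mu y0 t / ln t - 1) <= A * (ln (ln t) / ln t)).

Definition iterate (mu : R -> R) (y0 : R) (r : nat) (t : R) : R :=
  Nat.iter r (phi1 mu y0) t.

(* T^[r]; the preimage under phi1 is the one in (T0, +oo), where phi1 is
   strictly increasing. *)
Definition reverse_iterate (mu : R -> R) (y0 T0 : R) (r : nat) (T : R) : R :=
  Nat.iter r (fun T' => iota (fun t : R => T0 < t /\ phi1 mu y0 t = T')) T.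

(* product of g r over m <= r < m + len *)
Definition Rprod (m len : nat) (g : nat -> R) : R :=
  fold_right Rmult 1 (map g (seq m len)).

Definition f1 (t : R) : R := sin t ^ 2.
Definition f2 (t : R) : R := cos t ^ 2.

Definition F0 (mu : R -> R) (y0 : R) (k : nat) (t : R) : R :=
  Rprod 0 k (fun r => Ztilde2 mu y0 (iterate mu y0 r t)).

Definition F (mu : R -> R) (y0 : R) (f : R -> R) (k : nat) (t : R) : R :=
  f (iterate mu y0 k t) * F0 mu y0 k t.

Definition mean_value_point (g : R -> R) (a b c : R) : Prop :=
  a < c < b /\ g c = / (b - a) * RInt g a b.

(* d X U k is a mean-value point of g k on (X^[k], (X+U)^[k]) for
   X = PI * L, all large natural L, all U in (0, PI/4) and 1 <= k <= k0. *)
Definition mean_value_choice (mu : R -> R) (y0 T0 : R) (k0 : nat)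
    (g : nat -> R -> R) (d : R -> R -> nat -> R) : Prop :=
  exists L1 : nat, forall (U : R) (L k : nat),
    0 < U < PI / 4 -> (L1 <= L)%nat -> (1 <= k <= k0)%nat ->
    mean_value_point (g k)
      (reverse_iterate mu y0 T0 k (PI * INR L))
      (reverse_iterate mu y0 T0 k (PI * INR L + U))
      (d U (PI * INR L) k).

(* alpha_r (r = 0..k) from d = d_j, and beta_r (r = 1..k) from d = e. *)
Definition ladder_point (mu : R -> R) (y0 : R) (d : R -> R -> nat -> R)
    (U X : R) (k r : nat) : R :=
  iterate mu y0 (k - r) (d U X k).

Definition in_strip (s0 delta : R) (w : C) : Prop :=
  s0 - delta < Re w < s0 + delta /\ 0 < Im w.

Lemma Rcpow_lim0 (z : C) : Re z < 0 ->
  is_lim_seq (fun N => Rpower (INR N) (Re z)) 0.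
Proof.
intros Hz; unfold Rpower.
apply (is_lim_comp_seq exp (fun N => Re z * ln (INR N)) m_infty 0).
- exact is_lim_exp_m.
- exists 0%nat; intros n _; discriminate.
- assert (Hl : is_lim_seq (fun N => ln (INR N)) p_infty).
  { apply (is_lim_comp_seq ln INR p_infty p_infty); [exact is_lim_ln_p| |exact is_lim_seq_INR].
    exists 0%nat; intros n _; discriminate. }
  replace m_infty with (Rbar_mult (Re z) p_infty).
  + now apply is_lim_seq_scal_l.
  + simpl; case Rle_dec; intros H; [exfalso; lra|reflexivity].
Qed.

Lemma Re_Im_le (z : C) : Rabs (Re z) <= Cmod z /\ Rabs (Im z) <= Cmod z.
Proof.
pose proof (Rmax_Cmod z) as H; split; eapply Rle_trans; try exact H;
 [apply Rmax_l|apply Rmax_r].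
Qed.

Lemma Cmod_Rcpow x z : Cmod (Rcpow x z) = Rpower x (Re z).
Proof.
unfold Cmod, Rcpow; simpl.
match goal with |- sqrt ?u = _ => replace u with (Rsqr (Rpower x (Re z))) end.
- rewrite sqrt_Rsqr; [easy|unfold Rpower; apply Rlt_le, exp_pos].
- pose proof (sin2_cos2 (Im z * ln x)) as H; unfold Rsqr in *.
  set (a := Rpower _ _) in *; set (c := cos _) in *; set (d := sin _) in *.
  transitivity (a * a * (d * d + c * c)); [rewrite H; ring|ring].
Qed.

Lemma zeta_dirichlet (s l : C) : 1 < Re s ->
  is_series (V := C_NormedModule) (fun n => Rcpow (INR (S n)) (Copp s)) l ->
  zeta s = l.
Proof.
intros Hs Hl.
assert (H1 : (1 - s)%C <> 0%C).
{ intros E; apply (f_equal Re) in E; unfold Re in *; simpl in E; lra. }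
assert (H : is_lim_seq (fun N => Cmod (zeta_approx s N - l)%C) 0).
{ assert (Ha : is_lim_seq (fun N => Cmod (sum_n_m (fun n : nat => Rcpow (INR n) (Copp s)) 1 N - l)%C) 0).
  { apply is_lim_seq_incr_1.
    apply is_lim_seq_spec; intros eps.
    assert (He : 0 < eps / 2) by (destruct eps; simpl; lra).
    pose proof (proj1 (filterlim_locally_ball_norm _ _) Hl eps) as [N HN].
    exists N; intros n Hn; specialize (HN n Hn).
    unfold ball_norm in HN.
    rewrite Rminus_0_r, Rabs_pos_eq by apply Cmod_ge_0.
    unfold sum_n in HN; rewrite (sum_n_m_S (fun k => Rcpow (INR k) (Copp s))) in HN.
    exact HN. }
  assert (Hb : is_lim_seq (fun N => Cmod (Rcpow (INR N) (1 - s) / (1 - s))%C) 0).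
  { apply is_lim_seq_ext with (fun N => / Cmod (1 - s)%C * Rpower (INR N) (Re (1 - s)%C)).
    { intros n; rewrite Cmod_div by exact H1; rewrite Cmod_Rcpow.
      unfold Rdiv; ring. }
    replace (Finite 0) with (Rbar_mult (/ Cmod (1 - s)%C) 0).
    - apply is_lim_seq_scal_l, Rcpow_lim0; unfold Re in *; simpl; lra.
    - simpl; now rewrite Rmult_0_r. }
  pose proof (is_lim_seq_plus' _ _ _ _ Ha Hb) as Hc.
  rewrite Rplus_0_r in Hc.
  apply is_lim_seq_le_le with (2 := is_lim_seq_const 0) (3 := Hc).
  intros n; split; [apply Cmod_ge_0|].
  unfold zeta_approx.
  rewrite <- (Cmod_opp (Rcpow (INR n) (1 - s) / (1 - s))%C).
  match goal with |- Cmod ?u <= Cmod ?v + Cmod ?w =>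
    replace u with (v + w)%C by ring end.
  apply Cmod_triangle. }
assert (K : forall (p : C -> R),
   (forall z, Rabs (p z) <= Cmod z) ->
   (forall z z', p (z - z')%C = p z - p z') ->
   Lim_seq (fun N => p (zeta_approx s N)) = p l).
{ intros p Hp Hm; apply is_lim_seq_unique.
  assert (H0 : is_lim_seq (fun N => p (zeta_approx s N) - p l) 0).
  { apply is_lim_seq_abs_0.
    apply is_lim_seq_le_le with (2 := is_lim_seq_const 0) (3 := H).
    intros n; split; [apply Rabs_pos|rewrite <- Hm; apply Hp]. }
  pose proof (is_lim_seq_plus' _ _ _ _ H0 (is_lim_seq_const (p l))) as H2.
  rewrite Rplus_0_l in H2.
  eapply is_lim_seq_ext; [|exact H2]; intros n; simpl; ring. }
unfold zeta; rewrite (K Re), (K Im).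
- now destruct l.
- apply Re_Im_le.
- intros [] []; reflexivity.
- apply Re_Im_le.
- intros [] []; reflexivity.
Qed.

(* Main.v *)
Require Import Defs.
From Stdlib Require Import Reals Ranalysis5 Lra Lia ClassicalEpsilon.
From Coquelicot Require Import Coquelicot.
From Stdlib Require Import List.
Open Scope R_scope.

(* Substituting phi_1^k in the integrals defining the mean-value points gives
     prod_r Ztilde2 (alpha_r) / Ztilde2 (beta_r) * f (alpha_0)
       = 1/U * int_(pi L)^(pi L + U) f,
   and these means of sin^2 and cos^2 add up to 1.  So it is enough to pick w_j with
   |zeta w_j| = f_j (alpha_0^j), that is, to show that |zeta| takes every value v in (0, 1]
   on each line Re s = sg, 1/2 < sg < 1, Im s > 0.

   Near the real axis |zeta| > 1, so by continuity small values suffice.  If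
   |zeta (sg + it)| >= m for t >= 1, then eta = (1 - 2^(1-s)) zeta is also bounded below.
   Let W be the product over odd primes p <= N of (1 - p^(-s)) (1 - p^(sg-s)) and x = p^(-sg).
   The mean square of W is prod (2 + 2x + 2x^2).  In W * eta the factors 1 - p^(-s) sieve
   the series and each 1 - p^(sg-s) doubles the mean square, which is therefore at most
   zeta (2 sg) * prod 2.  Hence m^2 * prod (1 + x + x^2) stays bounded, contradicting the
   divergence of sum 1/p. *)

(** * Powers *)

(** The value 0 is out of reach, as zeros of zeta to the right of the critical line are not known to
    exist; hence the two means must be seen to be positive. Small values on a prescribed line are
    forced by comparing mean squares, where bounded losses, such as the factor 2 from squaring a
    sum, are harmless because the gain is unbounded. The polynomial [W] is fixed before the length N
    and the height T tend to infinity, so its own length never competes with T. Passing to eta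
    serves the same purpose: its partial sums of length N approximate it uniformly for t up to a
    fixed fraction of N, without a pole term. So N and T may have the same order, and for sg > 1/2
    the cross terms, bounded one by one, add up to o(T). On the line the term p^(sg-s) = p^(-it) is
    unimodular. In [W] it correlates with p^(-s), and this correlation is the term 2x in 2 + 2x +
    2x^2; in W * eta the sieved series and its shifted copy have disjoint supports, so nothing
    beyond the factor 2 appears. *)

Lemma Rpower_pos (x a : R) : 0 < Rpower x a.
Proof. apply exp_pos. Qed.

Lemma Rpower_1_l (a : R) : Rpower 1 a = 1.
Proof. unfold Rpower; rewrite ln_1, Rmult_0_r; apply exp_0. Qed.

Lemma Rpower_le_decr (x y a : R) : a <= 0 -> 0 < x <= y -> Rpower y a <= Rpower x a.
Proof.
intros Ha [Hx Hxy].
assert (Hl : ln x <= ln y) by (apply ln_le; lra).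
unfold Rpower; destruct (Req_dec (a * ln y) (a * ln x)) as [->|Hn]; [lra|].
apply Rlt_le, exp_increasing; nra.
Qed.

Lemma Rpower_minus_one (x a : R) : 0 < x -> Rpower x (a - 1) = Rpower x a / x.
Proof.
intros Hx; unfold Rminus; rewrite Rpower_plus, (Rpower_Ropp x 1), Rpower_1 by easy.
reflexivity.
Qed.

Lemma is_derive_Rpower (a x : R) : 0 < x ->
  is_derive (fun u => Rpower u a) x (a * Rpower x (a - 1)).
Proof. intros Hx; apply is_derive_Reals; now apply derivable_pt_lim_power. Qed.

Lemma Rpower_diff (a x y : R) : 0 < x < y ->
  exists c, x <= c <= y /\ Rpower y a - Rpower x a = a * Rpower c (a - 1) * (y - x).
Proof.
intros [Hx Hxy].
destruct (MVT_gen (fun u => Rpower u a) x y (fun u => a * Rpower u (a - 1)))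
  as [c [Hc E]].
- rewrite Rmin_left, Rmax_right by lra; intros u Hu; apply is_derive_Rpower; lra.
- rewrite Rmin_left, Rmax_right by lra; intros u Hu.
  apply continuity_pt_filterlim, (ex_derive_continuous (fun u => Rpower u a)).
  eexists; apply is_derive_Rpower; lra.
- rewrite Rmin_left, Rmax_right in Hc by lra; now exists c.
Qed.

Lemma INR_S_pos (n : nat) : 0 < INR (S n).
Proof. apply lt_0_INR; lia. Qed.

Lemma INR_ge_one (n : nat) : (1 <= n)%nat -> 1 <= INR n.
Proof. intros H; apply (le_INR 1); exact H. Qed.

Lemma Rpower_step_ge (th : R) (n : nat) : 0 < th <= 1 -> (1 <= n)%nat ->
  Rpower (INR (S n)) (th - 1) <= (Rpower (INR (S n)) th - Rpower (INR n) th) / th.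
Proof.
intros Hth Hn; apply INR_ge_one in Hn.
destruct (Rpower_diff th (INR n) (INR (S n))) as [c [Hc ->]].
{ rewrite S_INR; lra. }
rewrite S_INR in *.
replace (th * Rpower c (th - 1) * (INR n + 1 - INR n) / th) with (Rpower c (th - 1))
  by (field; lra).
apply Rpower_le_decr; lra.
Qed.

(** Integral comparison, telescoped through [Rpower_step_ge]. For [th = 1 - sg] the growing term
    N^th / th is the one that [zeta_approx] subtracts at a real point. *)
Lemma sum_Rpower_le (th : R) (N : nat) : 0 < th <= 1 -> (1 <= N)%nat ->
  sum_n_m (fun n => Rpower (INR n) (th - 1)) 1 N <= 1 + (Rpower (INR N) th - 1) / th.
Proof.
intros Hth; induction N as [|N IH]; [lia|intros _].
destruct N as [|N].
- rewrite sum_n_n; simpl; rewrite !Rpower_1_l; lra.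
- rewrite sum_n_Sm by lia.
  specialize (IH ltac:(lia)).
  pose proof (Rpower_step_ge th (S N) Hth ltac:(lia)) as H.
  change plus with Rplus.
  replace (1 + (Rpower (INR (S (S N))) th - 1) / th)
    with ((1 + (Rpower (INR (S N)) th - 1) / th)
          + (Rpower (INR (S (S N))) th - Rpower (INR (S N)) th) / th)
    by (field; lra).
  lra.
Qed.

Lemma Rpower_neg_step (a : R) (n : nat) : 0 < a -> (1 <= n)%nat ->
  a * Rpower (INR (S n)) (- a - 1) <= Rpower (INR n) (- a) - Rpower (INR (S n)) (- a).
Proof.
intros Ha Hn; apply INR_ge_one in Hn.
destruct (Rpower_diff (- a) (INR n) (INR (S n))) as [c [Hc E]].
{ rewrite S_INR; lra. }
rewrite S_INR in *.
assert (Rpower (INR n + 1) (- a - 1) <= Rpower c (- a - 1))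
  by (apply Rpower_le_decr; lra).
nra.
Qed.

Lemma Rpower_lim_0 (a : R) : a < 0 -> is_lim_seq (fun N => Rpower (INR N) a) 0.
Proof. intros Ha; exact (Rcpow_lim0 (a, 0) Ha). Qed.

(** * Complex powers *)

Lemma Cmod_le_Re_Im (z : C) : Cmod z <= Rabs (Re z) + Rabs (Im z).
Proof.
destruct z as [x y]; simpl.
replace (x, y) with (RtoC x + (0, y))%C by (apply injective_projections; simpl; ring).
eapply Rle_trans; [apply Cmod_triangle|].
rewrite Cmod_R; apply Rplus_le_compat_l, Req_le.
unfold Cmod; simpl; rewrite <- (sqrt_Rsqr_abs y); f_equal; unfold Rsqr; ring.
Qed.

Lemma Rcpow_mult_l (x y : R) (z : C) : 0 < x -> 0 < y ->
  Rcpow (x * y) z = (Rcpow x z * Rcpow y z)%C.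
Proof.
intros Hx Hy; unfold Rcpow.
rewrite ln_mult, <- Rpower_mult_distr, Rmult_plus_distr_l, cos_plus, sin_plus by easy.
apply injective_projections; simpl; ring.
Qed.

Lemma Rcpow_plus_r (x : R) (z w : C) : Rcpow x (z + w) = (Rcpow x z * Rcpow x w)%C.
Proof.
destruct z as [a b], w as [c d]; unfold Rcpow; simpl.
rewrite Rpower_plus, Rmult_plus_distr_r, cos_plus, sin_plus.
apply injective_projections; simpl; ring.
Qed.

Lemma Rcpow_1_r (x : R) : 0 < x -> Rcpow x 1 = x.
Proof.
intros Hx; unfold Rcpow; simpl.
rewrite Rpower_1, Rmult_0_l, cos_0, sin_0 by easy.
apply injective_projections; simpl; ring.
Qed.

Lemma Rcpow_1_l (z : C) : Rcpow 1 z = 1.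
Proof.
unfold Rcpow, Rpower; rewrite ln_1, !Rmult_0_r, exp_0, cos_0, sin_0.
apply injective_projections; simpl; ring.
Qed.

Lemma exp_minus_ln (b x : R) : 0 < x -> exp (b - ln x) = exp b / x.
Proof. intros Hx; unfold Rminus; now rewrite exp_plus, exp_Ropp, exp_ln. Qed.

Lemma is_derive_Re_Rcpow (z : C) (u : R) : 0 < u ->
  is_derive (fun u => Re (Rcpow u z)) u (Re (z * Rcpow u (z - 1))%C).
Proof.
intros Hu; destruct z as [a b]; unfold Rcpow, Rpower; simpl.
replace (b + - 0) with b by ring.
replace ((a + - (1)) * ln u) with (a * ln u - ln u) by ring.
auto_derive; [lra|].
rewrite (exp_minus_ln (a * ln u) u Hu); field; lra.
Qed.

Lemma is_derive_Im_Rcpow (z : C) (u : R) : 0 < u ->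
  is_derive (fun u => Im (Rcpow u z)) u (Im (z * Rcpow u (z - 1))%C).
Proof.
intros Hu; destruct z as [a b]; unfold Rcpow, Rpower; simpl.
replace (b + - 0) with b by ring.
replace ((a + - (1)) * ln u) with (a * ln u - ln u) by ring.
auto_derive; [lra|].
rewrite (exp_minus_ln (a * ln u) u Hu); field; lra.
Qed.

(** A complex function need not attain its mean slope, so the mean value theorem is applied to each
    coordinate; each costs [D], whence the factor 2. *)
Lemma complex_mean_value (f df : R -> C) (x y D : R) : x <= y ->
  (forall u, x <= u <= y -> is_derive (fun u => Re (f u)) u (Re (df u))) ->
  (forall u, x <= u <= y -> is_derive (fun u => Im (f u)) u (Im (df u))) ->
  (forall u, x <= u <= y -> Cmod (df u) <= D) ->
  Cmod (f y - f x)%C <= 2 * D * (y - x).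
Proof.
intros Hxy HR HI HD.
assert (K : forall (p : C -> R), (forall z, Rabs (p z) <= Cmod z) ->
  (forall u, x <= u <= y -> is_derive (fun u => p (f u)) u (p (df u))) ->
  Rabs (p (f y) - p (f x)) <= D * (y - x)).
{ intros p Hp Hd.
  destruct (MVT_gen (fun u => p (f u)) x y (fun u => p (df u))) as [c [Hc ->]].
  - rewrite Rmin_left, Rmax_right by lra; intros u Hu; apply Hd; lra.
  - rewrite Rmin_left, Rmax_right by lra; intros u Hu.
    apply continuity_pt_filterlim, (ex_derive_continuous (fun u => p (f u))).
    eexists; apply Hd; lra.
  - rewrite Rmin_left, Rmax_right in Hc by lra.
    rewrite Rabs_mult, (Rabs_pos_eq (y - x)) by lra.
    apply Rmult_le_compat_r; [lra|].
    eapply Rle_trans; [apply Hp|now apply HD]. }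
eapply Rle_trans; [apply Cmod_le_Re_Im|].
pose proof (K Re (fun z => proj1 (Re_Im_le z)) HR).
pose proof (K Im (fun z => proj2 (Re_Im_le z)) HI).
replace (Re (f y - f x)%C) with (Re (f y) - Re (f x)) by (unfold Re; simpl; ring).
replace (Im (f y - f x)%C) with (Im (f y) - Im (f x)) by (unfold Im; simpl; ring).
lra.
Qed.

Lemma Rcpow_diff_le (z : C) (x y : R) : Re z <= 1 -> 0 < x <= y ->
  Cmod (Rcpow y z - Rcpow x z)%C <= 2 * (Cmod z * Rpower x (Re z - 1)) * (y - x).
Proof.
intros Hz [Hx Hxy].
apply (complex_mean_value (fun u => Rcpow u z) (fun u => z * Rcpow u (z - 1))%C).
- exact Hxy.
- intros u Hu; apply is_derive_Re_Rcpow; lra.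
- intros u Hu; apply is_derive_Im_Rcpow; lra.
- intros u Hu; rewrite Cmod_mult, Cmod_Rcpow.
  apply Rmult_le_compat_l; [apply Cmod_ge_0|].
  replace (Re (z - 1)%C) with (Re z - 1) by (unfold Re; simpl; ring).
  apply Rpower_le_decr; lra.
Qed.

(** The mean value theorem gives the power at n + 1; moving back to n costs 2^(a+1), which is at
    most 4 as a <= 1. This supplies n^(-a-1) with a telescoping majorant. *)
Lemma Rpower_neg_step_l (a : R) (n : nat) : 0 < a <= 1 -> (1 <= n)%nat ->
  Rpower (INR n) (- a - 1) <= 4 / a * (Rpower (INR n) (- a) - Rpower (INR (S n)) (- a)).
Proof.
intros Ha Hn.
pose proof (Rpower_neg_step a n ltac:(lra) Hn) as H.
apply INR_ge_one in Hn.
assert (H4 : / 4 <= Rpower 2 (- a - 1)).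
{ replace (/ 4) with (Rpower 2 (- (2))).
  - apply Rle_Rpower; lra.
  - rewrite Rpower_Ropp; replace 2 with (INR 2) at 2 by reflexivity.
    rewrite Rpower_pow by lra; simpl; f_equal; lra. }
assert (Hd : / 4 * Rpower (INR n) (- a - 1) <= Rpower (INR (S n)) (- a - 1)).
{ apply Rle_trans with (Rpower 2 (- a - 1) * Rpower (INR n) (- a - 1)).
  - apply Rmult_le_compat_r; [apply Rlt_le, Rpower_pos|exact H4].
  - rewrite Rpower_mult_distr by lra; apply Rpower_le_decr; [lra|].
    rewrite S_INR; lra. }
replace (4 / a * (Rpower (INR n) (- a) - Rpower (INR (S n)) (- a)))
  with (4 * ((Rpower (INR n) (- a) - Rpower (INR (S n)) (- a)) / a)) by (field; lra).
apply Rle_trans with (4 * Rpower (INR (S n)) (- a - 1)); [lra|].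
apply Rmult_le_compat_l; [lra|].
apply Rmult_le_reg_l with a; [lra|]; field_simplify; lra.
Qed.

Lemma Cmod_minus_le (f : nat -> C) (g : nat -> R) (n0 : nat) :
  (forall n, (n0 <= n)%nat -> Cmod (f (S n) - f n)%C <= g n - g (S n)) ->
  forall n m, (n0 <= n)%nat -> (n <= m)%nat -> Cmod (f m - f n)%C <= g n - g m.
Proof.
intros H n m Hn Hm; induction Hm as [|m Hm IH].
- replace (f n - f n)%C with (RtoC 0) by ring; rewrite Cmod_0; lra.
- replace (f (S m) - f n)%C with ((f (S m) - f m) + (f m - f n))%C by ring.
  eapply Rle_trans; [apply Cmod_triangle|].
  specialize (H m ltac:(lia)); lra.
Qed.

(** The majorant [g] makes both coordinates Cauchy, so the [Lim_seq] terms, of the same shape as in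
    [zeta], are genuine finite limits. Adding the two coordinate errors gives the factor 2. *)
Lemma Cmod_limit_le (f : nat -> C) (g : nat -> R) (n0 : nat) :
  (forall n, (n0 <= n)%nat -> Cmod (f (S n) - f n)%C <= g n - g (S n)) ->
  (forall n, 0 <= g n) -> is_lim_seq g 0 ->
  forall n, (n0 <= n)%nat ->
  Cmod ((real (Lim_seq (fun k => Re (f k))), real (Lim_seq (fun k => Im (f k))))
        - f n)%C <= 2 * g n.
Proof.
intros H Hg Hg0.
assert (K : forall (p : C -> R), (forall z, Rabs (p z) <= Cmod z) ->
  (forall z w, p (z - w)%C = p z - p w) ->
  forall n, (n0 <= n)%nat -> Rabs (real (Lim_seq (fun k => p (f k))) - p (f n)) <= g n).
{ intros p Hp Hm.
  assert (B : forall n m, (n0 <= n)%nat -> (n <= m)%nat -> Rabs (p (f m) - p (f n)) <= g n).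
  { intros n m Hn Hnm; rewrite <- Hm; eapply Rle_trans; [apply Hp|].
    pose proof (Cmod_minus_le f g n0 H n m Hn Hnm); pose proof (Hg m); lra. }
  assert (Hc : ex_finite_lim_seq (fun k => p (f k))).
  { apply ex_lim_seq_cauchy_corr; intros eps.
    apply is_lim_seq_spec in Hg0; destruct (Hg0 eps) as [N HN].
    assert (HN' : forall n, (N <= n)%nat -> g n < eps).
    { intros n Hn; specialize (HN n Hn); rewrite Rminus_0_r, Rabs_pos_eq in HN; auto. }
    exists (max N n0); intros n m Hn Hm'.
    destruct (Nat.le_ge_cases n m) as [Hnm|Hnm].
    - rewrite Rabs_minus_sym; eapply Rle_lt_trans; [apply B|apply HN']; lia.
    - eapply Rle_lt_trans; [apply B|apply HN']; lia. }
  apply Lim_seq_correct' in Hc.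
  set (l := real _) in *.
  intros n Hn.
  assert (Hl : is_lim_seq (fun k => Rabs (p (f k) - p (f n))) (Rabs (l - p (f n)))).
  { apply (is_lim_seq_abs _ (l - p (f n))).
    apply is_lim_seq_minus'; [exact Hc|apply is_lim_seq_const]. }
  apply (is_lim_seq_le_loc _ _ _ _ (ex_intro _ n (fun m Hm => B n m Hn Hm)) Hl
           (is_lim_seq_const (g n))). }
intros n Hn; eapply Rle_trans; [apply Cmod_le_Re_Im|].
replace (2 * g n) with (g n + g n) by ring.
apply Rplus_le_compat.
- apply (K Re); [intros z; apply Re_Im_le|intros [] []; reflexivity|exact Hn].
- apply (K Im); [intros z; apply Re_Im_le|intros [] []; reflexivity|exact Hn].
Qed.

(** * The zeta-function in the critical strip *)

Lemma one_minus_neq_0 (s : C) : Re s < 1 -> (1 - s)%C <> 0%C.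
Proof.
intros Hs E; apply (f_equal Re) in E; unfold Re in *; simpl in E; lra.
Qed.

(** The step is (N+1)^(-s) minus the integral of u^(-s) over [N, N+1]. It is the increment of (k u -
    u^(1-s)) / (1-s), whose derivative (N+1)^(-s) - u^(-s) is O(|s| N^(-Re s - 1)). *)
Lemma zeta_approx_step (s : C) (N : nat) : 0 < Re s < 1 -> (1 <= N)%nat ->
  Cmod (zeta_approx s (S N) - zeta_approx s N)%C
  <= 4 * Cmod s * Rpower (INR N) (- Re s - 1).
Proof.
intros Hs HN.
pose proof (one_minus_neq_0 s ltac:(lra)) as H1.
pose proof (INR_ge_one N HN) as HN'.
set (k := ((1 - s) * Rcpow (INR (S N)) (- s))%C).
assert (Hstep : (zeta_approx s (S N) - zeta_approx s N)%C =
  (((k * INR (S N) - Rcpow (INR (S N)) (1 - s)) - (k * INR N - Rcpow (INR N) (1 - s)))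
   / (1 - s))%C).
{ unfold zeta_approx; rewrite sum_n_Sm by lia; change plus with Cplus.
  replace (INR (S N)) with (INR N + 1) at 3 by (rewrite S_INR; ring).
  rewrite RtoC_plus; unfold k.
  field; exact H1. }
rewrite Hstep, Cmod_div by exact H1.
assert (Hd : forall u, INR N <= u <= INR (S N) ->
  Cmod (k - (1 - s) * Rcpow u (1 - s - 1))%C
  <= Cmod (1 - s) * (2 * Cmod s * Rpower (INR N) (- Re s - 1))).
{ intros u Hu; unfold k.
  replace (1 - s - 1)%C with (- s)%C by ring.
  replace ((1 - s) * Rcpow (INR (S N)) (- s) - (1 - s) * Rcpow u (- s))%C
    with ((1 - s) * (Rcpow (INR (S N)) (- s) - Rcpow u (- s)))%C by ring.
  rewrite Cmod_mult; apply Rmult_le_compat_l; [apply Cmod_ge_0|].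
  replace (2 * Cmod s * Rpower (INR N) (- Re s - 1))
    with (2 * (Cmod s * Rpower (INR N) (- Re s - 1)) * 1) by ring.
  eapply Rle_trans; [apply Rcpow_diff_le|]; rewrite ?Cmod_opp.
  - unfold Re in *; simpl; lra.
  - lra.
  - change (Re (- s)%C) with (- Re s).
    rewrite S_INR in *.
    apply Rmult_le_compat; try lra.
    + apply Rmult_le_pos; [lra|apply Rmult_le_pos; [apply Cmod_ge_0|apply Rlt_le, Rpower_pos]].
    + apply Rmult_le_compat_l; [lra|].
      apply Rmult_le_compat_l; [apply Cmod_ge_0|].
      apply Rpower_le_decr; lra. }
apply Rmult_le_reg_r with (Cmod (1 - s)); [now apply Cmod_gt_0|].
unfold Rdiv; rewrite Rmult_assoc, Rinv_l, Rmult_1_r by now apply Rgt_not_eq, Cmod_gt_0.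
replace (4 * Cmod s * Rpower (INR N) (- Re s - 1) * Cmod (1 - s))
  with (2 * (Cmod (1 - s) * (2 * Cmod s * Rpower (INR N) (- Re s - 1)))
        * (INR (S N) - INR N)) by (rewrite S_INR; ring).
clearbody k.
apply (complex_mean_value (fun u => k * u - Rcpow u (1 - s))%C
         (fun u => k - (1 - s) * Rcpow u (1 - s - 1))%C).
- rewrite S_INR; lra.
- intros u Hu.
  apply is_derive_ext with (fun u => Re k * u - Re (Rcpow u (1 - s))).
  { intros v; destruct k; unfold Re; simpl; ring. }
  replace (Re (k - (1 - s) * Rcpow u (1 - s - 1))%C)
    with (Re k - Re ((1 - s) * Rcpow u (1 - s - 1))%C) by reflexivity.
  apply (is_derive_minus (fun u => Re k * u)).
  + auto_derive; [easy|]. ring.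
  + apply is_derive_Re_Rcpow; lra.
- intros u Hu.
  apply is_derive_ext with (fun u => Im k * u - Im (Rcpow u (1 - s))).
  { intros v; destruct k; unfold Im; simpl; ring. }
  replace (Im (k - (1 - s) * Rcpow u (1 - s - 1))%C)
    with (Im k - Im ((1 - s) * Rcpow u (1 - s - 1))%C) by reflexivity.
  apply (is_derive_minus (fun u => Im k * u)).
  + auto_derive; [easy|]; ring.
  + apply is_derive_Im_Rcpow; lra.
- exact Hd.
Qed.

(** The constant 32 is 4 from the size of a step, 4 from telescoping and 2 from the passage to the
    limit. The factor |s| makes this useless for large t, but it suffices for continuity and for
    identifying limits. *)
Lemma zeta_approx_error (s : C) (N : nat) : 0 < Re s < 1 -> (1 <= N)%nat ->
  Cmod (zeta s - zeta_approx s N)%C <= 32 * Cmod s / Re s * Rpower (INR N) (- Re s).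
Proof.
intros Hs HN.
replace (32 * Cmod s / Re s * Rpower (INR N) (- Re s))
  with (2 * (16 * Cmod s / Re s * Rpower (INR N) (- Re s))) by (field; lra).
assert (Hc : 0 <= 16 * Cmod s / Re s).
{ apply Rmult_le_pos; [pose proof (Cmod_ge_0 s); lra|].
  apply Rlt_le, Rinv_0_lt_compat; lra. }
apply (Cmod_limit_le (zeta_approx s)
  (fun n => 16 * Cmod s / Re s * Rpower (INR n) (- Re s)) 1); [| | |exact HN].
- intros n Hn; eapply Rle_trans; [now apply zeta_approx_step|].
  pose proof (Rpower_neg_step_l (Re s) n ltac:(lra) Hn) as H.
  apply (Rmult_le_compat_l (4 * Cmod s)) in H; [|pose proof (Cmod_ge_0 s); lra].
  eapply Rle_trans; [exact H|]; right; field; lra.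
- intros n; apply Rmult_le_pos; [exact Hc|apply Rlt_le, Rpower_pos].
- replace (Finite 0) with (Rbar_mult (16 * Cmod s / Re s) 0)
    by (simpl; now rewrite Rmult_0_r).
  apply is_lim_seq_scal_l, Rpower_lim_0; lra.
Qed.

(** By integral comparison every approximation at a real point is at most 1 - 1/(1-sg), and sg > 1/2
    puts this below -1. *)
Lemma Re_zeta_real_lt (sg : R) : 1 / 2 < sg < 1 -> Re (zeta (sg, 0)) < - 1.
Proof.
intros Hs.
assert (B : forall N, (1 <= N)%nat -> Re (zeta_approx (sg, 0) N) <= 1 - / (1 - sg)).
{ intros N HN.
  assert (E : Re (zeta_approx (sg, 0) N) =
     sum_n_m (fun n => Rpower (INR n) (1 - sg - 1)) 1 N - Rpower (INR N) (1 - sg) / (1 - sg)).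
  { assert (ES : Re (sum_n_m (fun n : nat => Rcpow (INR n) (- (sg, 0))%C) 1 N)
                 = sum_n_m (fun n => Rpower (INR n) (1 - sg - 1)) 1 N).
    { clear HN; induction N as [|N IH].
      - rewrite !sum_n_m_zero by lia; reflexivity.
      - rewrite !sum_n_Sm by lia.
        change (Re (sum_n_m (fun n : nat => Rcpow (INR n) (- (sg, 0))%C) 1 N)
          + Re (Rcpow (INR (S N)) (- (sg, 0))%C) =
          sum_n_m (fun n => Rpower (INR n) (1 - sg - 1)) 1 N
          + Rpower (INR (S N)) (1 - sg - 1)).
        rewrite IH; f_equal.
        unfold Rcpow; simpl Re; simpl Im.
        replace (1 - sg - 1) with (- sg) by ring.
        rewrite Ropp_0, Rmult_0_l, cos_0; apply Rmult_1_r. }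
    unfold zeta_approx.
    match goal with |- Re (?a - ?b)%C = _ => transitivity (Re a - Re b); [reflexivity|] end.
    rewrite ES; f_equal.
    unfold Rcpow, Cdiv, Cinv; simpl.
    replace (0 + - 0) with 0 by ring; rewrite Rmult_0_l, cos_0, sin_0.
    unfold Rminus; field; lra. }
  rewrite E.
  pose proof (sum_Rpower_le (1 - sg) N ltac:(lra) HN) as H.
  eapply Rle_trans; [apply Rplus_le_compat_r, H|]; right; field; lra. }
assert (Hlim : Re (zeta (sg, 0)) <= 1 - / (1 - sg)).
{ assert (Hl : is_lim_seq (fun N => 32 * Cmod (sg, 0) / sg * Rpower (INR N) (- sg)
                                    + (1 - / (1 - sg))) (0 + (1 - / (1 - sg)))).
  { apply is_lim_seq_plus'; [|apply is_lim_seq_const].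
    replace (Finite 0) with (Rbar_mult (32 * Cmod (sg, 0) / sg) 0)
      by (simpl; now rewrite Rmult_0_r).
    apply is_lim_seq_scal_l, Rpower_lim_0; lra. }
  rewrite Rplus_0_l in Hl.
  refine (is_lim_seq_le_loc _ _ _ _ _ (is_lim_seq_const (Re (zeta (sg, 0)))) Hl).
  exists 1%nat; intros N HN.
  pose proof (zeta_approx_error (sg, 0) N ltac:(simpl; lra) HN) as H.
  change (Re (sg, 0)) with sg in H.
  pose proof (proj1 (Re_Im_le (zeta (sg, 0) - zeta_approx (sg, 0) N)%C)) as H2.
  replace (Re (zeta (sg, 0) - zeta_approx (sg, 0) N)%C)
    with (Re (zeta (sg, 0)) - Re (zeta_approx (sg, 0) N)) in H2 by reflexivity.
  pose proof (Rle_abs (Re (zeta (sg, 0)) - Re (zeta_approx (sg, 0) N))).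
  specialize (B N HN); lra. }
assert (2 < / (1 - sg)).
{ apply Rmult_lt_reg_l with (1 - sg); [lra|]; rewrite Rinv_r; lra. }
lra.
Qed.

(** * The alternating series *)

Definition dirichlet (a : nat -> R) (s : C) (N : nat) : C :=
  sum_n_m (fun n => RtoC (a n) * Rcpow (INR n) (- s))%C 1 N.

Definition altsign (n : nat) : R := (- 1) ^ S n.

(** The factor is 1 - 2^(1-s). It removes the pole, so that pure Dirichlet polynomials, without a
    term N^(1-s)/(1-s), approximate the function. *)
Definition eta (s : C) : C := ((1 - 2 * Rcpow 2 (- s)) * zeta s)%C.

Lemma dirichlet_S (a : nat -> R) (s : C) (N : nat) :
  dirichlet a s (S N) = (dirichlet a s N + RtoC (a (S N)) * Rcpow (INR (S N)) (- s))%C.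
Proof. unfold dirichlet; rewrite sum_n_Sm by lia; reflexivity. Qed.

Lemma altsign_sqr (n : nat) : altsign n * altsign n = 1.
Proof.
unfold altsign; rewrite <- Rpow_mult_distr; replace (-1 * -1) with 1 by ring.
apply pow1.
Qed.

Lemma Cmod_altsign (n : nat) : Cmod (altsign n) = 1.
Proof.
rewrite Cmod_R; pose proof (altsign_sqr n) as H.
unfold Rabs; destruct Rcase_abs; nra.
Qed.

(** The alternating sum is the full sum minus twice its even part. The pole corrections of the two
    approximations cancel because (2N)^(1-s) = 2^(1-s) N^(1-s). *)
Lemma dirichlet_altsign_double (s : C) (N : nat) : Re s < 1 -> (1 <= N)%nat ->
  dirichlet altsign s (2 * N)
  = (zeta_approx s (2 * N) - 2 * Rcpow 2 (- s) * zeta_approx s N)%C.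
Proof.
intros Hs HN.
assert (E : forall M, dirichlet altsign s (2 * M) =
  (sum_n_m (fun n : nat => Rcpow (INR n) (- s)) 1 (2 * M)
   - 2 * Rcpow 2 (- s) * sum_n_m (fun n : nat => Rcpow (INR n) (- s)) 1 M)%C).
{ induction M as [|M IH].
  - unfold dirichlet; rewrite !sum_n_m_zero by (simpl; lia).
    change zero with (RtoC 0); ring.
  - replace (2 * S M)%nat with (S (S (2 * M))) by lia.
    rewrite !dirichlet_S, IH, !sum_n_Sm by lia; change plus with Cplus.
    replace (altsign (S (2 * M))) with 1
      by (unfold altsign; rewrite <- !tech_pow_Rmult, pow_1_even; ring).
    replace (altsign (S (S (2 * M)))) with (Ropp 1)
      by (unfold altsign; rewrite <- !tech_pow_Rmult, pow_1_even; ring).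
    replace (INR (S (S (2 * M)))) with (2 * INR (S M))
      by (rewrite !S_INR, mult_INR; simpl; ring).
    rewrite (Rcpow_mult_l 2) by (try lra; apply INR_S_pos).
    rewrite RtoC_opp; ring. }
rewrite E; unfold zeta_approx.
rewrite mult_INR; replace (INR 2) with 2 by (simpl; ring).
rewrite (Rcpow_mult_l 2 (INR N) (1 - s)) by (try lra; apply lt_0_INR; lia).
replace (Rcpow 2 (1 - s)) with (2 * Rcpow 2 (- s))%C
  by (unfold Cminus; rewrite Rcpow_plus_r, Rcpow_1_r by lra; ring).
field; now apply one_minus_neq_0.
Qed.

Lemma Rcpow_0_r (x : R) : Rcpow x 0 = 1.
Proof.
unfold Rcpow, Rpower; simpl.
rewrite !Rmult_0_l, exp_0, cos_0, sin_0; apply injective_projections; simpl; ring.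
Qed.

Lemma Rcpow_S (s : C) (n : nat) : (1 <= n)%nat ->
  Rcpow (INR (S n)) (- s) = (Rcpow (INR n) (- s) * Rcpow (INR n / INR (S n)) s)%C.
Proof.
intros Hn; apply INR_ge_one in Hn; pose proof (INR_S_pos n) as HS.
assert (Hq : 0 < INR n / INR (S n)) by (apply Rdiv_lt_0_compat; lra).
replace (INR n) with (INR (S n) * (INR n / INR (S n))) at 1 by (field; lra).
rewrite Rcpow_mult_l, <- Cmult_assoc, <- Rcpow_plus_r by easy.
replace (- s + s)%C with (RtoC 0) by ring.
rewrite Rcpow_0_r; ring.
Qed.

Lemma ln_le_minus_one (x : R) : 0 < x -> ln x <= x - 1.
Proof.
intros Hx; rewrite <- (ln_exp (x - 1)); apply ln_le; [easy|].
pose proof (exp_ineq1_le (x - 1)); lra.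
Qed.

(* Consecutive terms of the alternating series are almost opposite as long as t <= n. *)
Lemma Re_ratio_pos (sg t : R) (n : nat) : 0 <= t <= INR n -> (1 <= n)%nat ->
  0 <= Re (Rcpow (INR n / INR (S n)) (sg, t)).
Proof.
intros Ht Hn; apply INR_ge_one in Hn; pose proof (INR_S_pos n) as HS.
assert (Hq : 0 < INR n / INR (S n)) by (apply Rdiv_lt_0_compat; lra).
change (0 <= Rpower (INR n / INR (S n)) sg * cos (t * ln (INR n / INR (S n)))).
apply Rmult_le_pos; [apply Rlt_le, Rpower_pos|].
assert (H1 : ln (INR n / INR (S n)) <= 0).
{ rewrite <- ln_1; apply ln_le; [easy|].
  apply Rmult_le_reg_r with (INR (S n)); [easy|].
  replace (INR n / INR (S n) * INR (S n)) with (INR n) by (field; lra).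
  rewrite S_INR; lra. }
assert (H2 : - / INR n <= ln (INR n / INR (S n))).
{ replace (INR n / INR (S n)) with (/ (INR (S n) / INR n)) by (field; lra).
  rewrite ln_Rinv by (apply Rdiv_lt_0_compat; lra).
  apply Ropp_le_contravar; eapply Rle_trans; [apply ln_le_minus_one|].
  - apply Rdiv_lt_0_compat; lra.
  - rewrite S_INR; right; field; lra. }
assert (H3 : - 1 <= t * ln (INR n / INR (S n))).
{ apply Rle_trans with (INR n * - / INR n); [right; field; lra|].
  apply Rle_trans with (INR n * ln (INR n / INR (S n))).
  - apply Rmult_le_compat_l; lra.
  - nra. }
assert (t * ln (INR n / INR (S n)) <= 0) by nra.
pose proof PI2_1.
apply cos_ge_0; lra.
Qed.

Lemma Cmod_one_plus_ge_one (z : C) : 0 <= Re z -> 1 <= Cmod (1 + z)%C.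
Proof.
intros Hz; eapply Rle_trans; [|apply (proj1 (Re_Im_le _))].
replace (Re (1 + z)%C) with (1 + Re z) by reflexivity.
rewrite Rabs_pos_eq; lra.
Qed.

Lemma Cmod_inv_one_plus_le (z : C) : 0 <= Re z -> Cmod (/ (1 + z))%C <= 1.
Proof.
intros Hz; pose proof (Cmod_one_plus_ge_one z Hz) as H.
rewrite Cmod_inv; [|intros E; rewrite E, Cmod_0 in H; lra].
apply Rle_trans with (/ 1); [apply Rinv_le_contravar|]; lra.
Qed.

Lemma Cmod_inv_one_plus_diff (z w : C) : 0 <= Re z -> 0 <= Re w ->
  Cmod (/ (1 + z) - / (1 + w))%C <= Cmod (w - z)%C.
Proof.
intros Hz Hw.
pose proof (Cmod_one_plus_ge_one z Hz) as H1.
pose proof (Cmod_one_plus_ge_one w Hw) as H2.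
assert (N1 : (1 + z)%C <> 0%C) by (intros E; rewrite E, Cmod_0 in H1; lra).
assert (N2 : (1 + w)%C <> 0%C) by (intros E; rewrite E, Cmod_0 in H2; lra).
replace (/ (1 + z) - / (1 + w))%C with ((w - z) * (/ (1 + z) * / (1 + w)))%C
  by (field; now split).
rewrite !Cmod_mult.
pose proof (Cmod_inv_one_plus_le z Hz); pose proof (Cmod_inv_one_plus_le w Hw).
pose proof (Cmod_ge_0 (/ (1 + z))%C); pose proof (Cmod_ge_0 (/ (1 + w))%C).
pose proof (Cmod_ge_0 (w - z)%C).
assert (Cmod (/ (1 + z)) * Cmod (/ (1 + w)) <= 1) by nra.
nra.
Qed.

(** Consecutive ratios n/(n+1) differ by 1/((n+1)(n+2)); since t <= n, the factor |s| of the
    derivative is at most n + 1 and cancels one of the two denominators. *)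
Lemma Cmod_ratio_diff (sg t : R) (n : nat) :
  0 < sg < 1 -> 0 <= t <= INR n -> (1 <= n)%nat ->
  Cmod (Rcpow (INR (S n) / INR (S (S n))) (sg, t) - Rcpow (INR n / INR (S n)) (sg, t))%C
  <= 4 / INR (S n).
Proof.
intros Hs Ht Hn; apply INR_ge_one in Hn.
rewrite !S_INR.
eapply Rle_trans; [apply Rcpow_diff_le; simpl; [lra|]|].
- split; [apply Rdiv_lt_0_compat; lra|].
  apply Rmult_le_reg_r with ((INR n + 1) * (INR n + 1 + 1)); [nra|].
  field_simplify; nra.
- simpl Re.
  replace ((INR n + 1) / (INR n + 1 + 1) - INR n / (INR n + 1))
    with (/ ((INR n + 1) * (INR n + 1 + 1))) by (field; lra).
  assert (Hm : Cmod (sg, t) <= INR n + 1).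
  { eapply Rle_trans; [apply Cmod_le_Re_Im|]; simpl; rewrite !Rabs_pos_eq; lra. }
  assert (Hp : Rpower (INR n / (INR n + 1)) (sg - 1) <= 2).
  { apply Rle_trans with (Rpower (/ 2) (sg - 1)).
    - apply Rpower_le_decr; [lra|split; [lra|]].
      apply Rmult_le_reg_r with (2 * (INR n + 1)); [lra|field_simplify; lra].
    - unfold Rpower at 1; rewrite ln_Rinv by lra.
      replace ((sg - 1) * - ln 2) with ((1 - sg) * ln 2) by ring.
      fold (Rpower 2 (1 - sg)).
      apply Rle_trans with (Rpower 2 1); [apply Rle_Rpower; lra|rewrite Rpower_1; lra]. }
  apply Rle_trans with (2 * ((INR n + 1) * 2) * / ((INR n + 1) * (INR n + 1 + 1))).
  + apply Rmult_le_compat_r; [apply Rlt_le, Rinv_0_lt_compat; nra|].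
    apply Rmult_le_compat_l; [lra|].
    apply Rmult_le_compat; [apply Cmod_ge_0|apply Rlt_le, Rpower_pos|easy|easy].
  + apply Rmult_le_reg_r with ((INR n + 1) * (INR n + 1 + 1)); [nra|].
    field_simplify; nra.
Qed.

(** In contrast with [zeta_approx_error], no factor |s| occurs: consecutive terms nearly cancel as
    long as t <= N. This uniformity is what allows N and T to be of the same order in the mean
    squares. *)
Lemma dirichlet_altsign_diff (sg t : R) (N M : nat) :
  0 < sg < 1 -> 0 <= t <= INR N -> (1 <= N)%nat -> (N <= M)%nat ->
  Cmod (dirichlet altsign (sg, t) M - dirichlet altsign (sg, t) N)%C
  <= (2 + 4 / sg) * Rpower (INR N) (- sg).
Proof.
intros Hs Ht HN HM; set (s := (sg, t)).
set (u := fun n => (RtoC (altsign n) * Rcpow (INR n) (- s))%C).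
set (rho := fun n => Rcpow (INR n / INR (S n)) s).
(* The correction [w n] makes the partial sums telescope with small steps
   (Kusmin-Landau): u (n+1) = - u n * rho n. *)
set (w := fun n => (u (S n) / (1 + rho (S n)))%C).
assert (Hpos : forall n, (N <= n)%nat -> 0 <= Re (rho n)).
{ intros n Hn; apply Re_ratio_pos; [|lia]; apply le_INR in Hn; lra. }
assert (Hu : forall n, (1 <= n)%nat -> Cmod (u n) = Rpower (INR n) (- sg)).
{ intros n Hn; unfold u; rewrite Cmod_mult, Cmod_altsign, Cmod_Rcpow, Rmult_1_l.
  reflexivity. }
assert (Hr : forall n, (1 <= n)%nat -> u (S n) = (- (u n * rho n))%C).
{ intros n Hn; unfold u, rho; rewrite Rcpow_S by easy.
  replace (altsign (S n)) with (- altsign n) by (unfold altsign; simpl; ring).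
  rewrite RtoC_opp; ring. }
assert (Hw : forall n, (N <= n)%nat -> Cmod (w n) <= Rpower (INR N) (- sg)).
{ intros n Hn; unfold w, Cdiv; rewrite Cmod_mult, Hu by lia.
  apply Rle_trans with (Rpower (INR N) (- sg) * 1); [|lra].
  apply Rmult_le_compat; [apply Rlt_le, Rpower_pos|apply Cmod_ge_0| |].
  - apply Rpower_le_decr; [lra|]; split; [apply lt_0_INR; lia|apply le_INR; lia].
  - apply Cmod_inv_one_plus_le, Hpos; lia. }
assert (Hstep : forall n, (N <= n)%nat ->
  Cmod ((dirichlet altsign s (S n) + w (S n)) - (dirichlet altsign s n + w n))%C
  <= 4 / sg * Rpower (INR n) (- sg) - 4 / sg * Rpower (INR (S n)) (- sg)).
{ intros n Hn.
  pose proof (Hpos (S n) ltac:(lia)) as P1; pose proof (Hpos (S (S n)) ltac:(lia)) as P2.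
  pose proof (Cmod_one_plus_ge_one _ P1) as Q1.
  pose proof (Cmod_one_plus_ge_one _ P2) as Q2.
  assert (N1 : (1 + rho (S n))%C <> 0%C) by (intros E; rewrite E, Cmod_0 in Q1; lra).
  assert (N2 : (1 + rho (S (S n)))%C <> 0%C) by (intros E; rewrite E, Cmod_0 in Q2; lra).
  (* Because u (n+1) * rho (n+1) = - u (n+2), the new term is absorbed by the corrections. Only the
     difference of two neighbouring factors 1/(1 + rho) is left, and it is O(1/n). *)
  assert (E : ((dirichlet altsign s (S n) + w (S n)) - (dirichlet altsign s n + w n))%C
    = (u (S (S n)) * (/ (1 + rho (S (S n))) - / (1 + rho (S n))))%C).
  { rewrite dirichlet_S; fold (u (S n)); unfold w.
    rewrite (Hr (S n)) by lia; field; now split. }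
  rewrite E, Cmod_mult, Hu by lia.
  apply Rle_trans with (Rpower (INR (S n)) (- sg) * (4 / INR (S n))).
  - apply Rmult_le_compat; [apply Rlt_le, Rpower_pos|apply Cmod_ge_0| |].
    + apply Rpower_le_decr; [lra|]; split; [apply lt_0_INR; lia|apply le_INR; lia].
    + eapply Rle_trans; [apply Cmod_inv_one_plus_diff; easy|].
      rewrite <- Cmod_opp.
      replace (- (rho (S n) - rho (S (S n))))%C with (rho (S (S n)) - rho (S n))%C by ring.
      eapply Rle_trans; [apply (Cmod_ratio_diff sg t (S n)); [easy| |lia]|].
      * split; [lra|]; apply Rle_trans with (INR N); [lra|apply le_INR; lia].
      * pose proof (INR_S_pos n); rewrite (S_INR (S n)).
        apply Rmult_le_compat_l; [lra|apply Rinv_le_contravar; lra].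
  - pose proof (Rpower_neg_step sg n ltac:(lra) ltac:(lia)) as H.
    rewrite (Rpower_minus_one (INR (S n))) in H by apply INR_S_pos.
    replace (4 / sg * Rpower (INR n) (- sg) - 4 / sg * Rpower (INR (S n)) (- sg))
      with (4 / sg * (Rpower (INR n) (- sg) - Rpower (INR (S n)) (- sg))) by ring.
    eapply Rle_trans; [|apply Rmult_le_compat_l; [|exact H]].
    + right; field; pose proof (INR_S_pos n); lra.
    + apply Rlt_le, Rdiv_lt_0_compat; lra. }
pose proof (Cmod_minus_le (fun n => dirichlet altsign s n + w n)%C
  (fun n => 4 / sg * Rpower (INR n) (- sg)) N Hstep N M ltac:(lia) HM) as H.
simpl in H.
replace (dirichlet altsign s M - dirichlet altsign s N)%C with
  ((dirichlet altsign s M + w M - (dirichlet altsign s N + w N)) + (w N + - w M))%C by ring.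
eapply Rle_trans; [apply Cmod_triangle|].
pose proof (Cmod_triangle (w N) (- w M)%C) as H2; rewrite Cmod_opp in H2.
pose proof (Hw N ltac:(lia)); pose proof (Hw M HM).
assert (0 < 4 / sg * Rpower (INR M) (- sg)).
{ apply Rmult_lt_0_compat; [apply Rdiv_lt_0_compat; lra|apply Rpower_pos]. }
lra.
Qed.

(** Compare with the length 2M and let M tend to infinity: [zeta_approx_error] identifies the limit
    as [eta] and its dependence on |s| disappears, while the distance from length 2M to length N is
    bounded uniformly. *)
Lemma eta_error (sg t : R) (N : nat) : 0 < sg < 1 -> 0 <= t <= INR N -> (1 <= N)%nat ->
  Cmod (eta (sg, t) - dirichlet altsign (sg, t) N)%C
  <= (2 + 4 / sg) * Rpower (INR N) (- sg).
Proof.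
intros Hs Ht HN; set (s := (sg, t)).
set (c := 32 * Cmod s / sg).
assert (Hc : 0 <= c).
{ apply Rmult_le_pos; [pose proof (Cmod_ge_0 s); lra|].
  apply Rlt_le, Rinv_0_lt_compat; lra. }
assert (Hl : is_lim_seq (fun M => 3 * c * Rpower (INR M) (- sg)
                + (2 + 4 / sg) * Rpower (INR N) (- sg)) (0 + (2 + 4 / sg) * Rpower (INR N) (- sg))).
{ apply is_lim_seq_plus'; [|apply is_lim_seq_const].
  replace (Finite 0) with (Rbar_mult (3 * c) 0) by (simpl; now rewrite Rmult_0_r).
  apply is_lim_seq_scal_l, Rpower_lim_0; lra. }
rewrite Rplus_0_l in Hl.
refine (is_lim_seq_le_loc _ _ _ _ _
          (is_lim_seq_const (Cmod (eta s - dirichlet altsign s N)%C)) Hl).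
exists N; intros M HM.
replace (eta s - dirichlet altsign s N)%C
  with ((eta s - dirichlet altsign s (2 * M))
        + (dirichlet altsign s (2 * M) - dirichlet altsign s N))%C by ring.
eapply Rle_trans; [apply Cmod_triangle|].
apply Rplus_le_compat; [|apply dirichlet_altsign_diff; (easy || lia)].
rewrite dirichlet_altsign_double by (simpl; lra || lia).
replace (eta s - (zeta_approx s (2 * M) - 2 * Rcpow 2 (- s) * zeta_approx s M))%C
  with ((zeta s - zeta_approx s (2 * M))
        + - (2 * Rcpow 2 (- s) * (zeta s - zeta_approx s M)))%C by (unfold eta; ring).
eapply Rle_trans; [apply Cmod_triangle|].
rewrite Cmod_opp, !Cmod_mult, Cmod_Rcpow, Cmod_R, (Rabs_pos_eq 2) by lra.
pose proof (zeta_approx_error s M ltac:(simpl; lra) ltac:(lia)) as E1.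
pose proof (zeta_approx_error s (2 * M) ltac:(simpl; lra) ltac:(lia)) as E2.
change (Re s) with sg in *; change (Re (- s)%C) with (- sg); fold c in E1, E2.
assert (P : Rpower (INR (2 * M)) (- sg) <= Rpower (INR M) (- sg)).
{ apply Rpower_le_decr; [lra|]; split; [apply lt_0_INR; lia|apply le_INR; lia]. }
assert (P2 : Rpower 2 (- sg) <= 1).
{ rewrite <- (Rpower_O 2) by lra; apply Rle_Rpower; lra. }
pose proof (Rpower_pos 2 (- sg)).
pose proof (Cmod_ge_0 (zeta s - zeta_approx s M)%C).
apply (Rmult_le_compat_l c) in P; [|easy].
nra.
Qed.

(** * Mean squares of Dirichlet polynomials *)

Lemma sum_le_loc (a b : nat -> R) (N : nat) :
  (forall n, (1 <= n <= N)%nat -> a n <= b n) -> sum_n_m a 1 N <= sum_n_m b 1 N.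
Proof.
induction N as [|N IH]; intros H.
- rewrite !sum_n_m_zero by lia; apply Rle_refl.
- rewrite !sum_n_Sm by lia; apply Rplus_le_compat; [apply IH; intros; apply H|apply H]; lia.
Qed.

Lemma sum_n_m_Rmult_l (c : R) (a : nat -> R) (n m : nat) :
  sum_n_m (fun k => c * a k) n m = c * sum_n_m a n m.
Proof. exact (sum_n_m_mult_l c a n m). Qed.

Lemma sum_n_m_Rplus (a b : nat -> R) (n m : nat) :
  sum_n_m (fun k => a k + b k) n m = sum_n_m a n m + sum_n_m b n m.
Proof. exact (sum_n_m_plus a b n m). Qed.

Lemma sum_n_m_RS (a : nat -> R) (N : nat) :
  sum_n_m a 1 (S N) = sum_n_m a 1 N + a (S N).
Proof. apply (sum_n_Sm a 1 N); lia. Qed.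

Definition coeff (a : nat -> R) (sg : R) (n : nat) : R := a n * Rpower (INR n) (- sg).

(** The diagonal part of the mean square of [dirichlet a (sg, t) N] in t. *)
Definition energy (a : nat -> R) (sg : R) (N : nat) : R :=
  sum_n_m (fun n => coeff a sg n ^ 2) 1 N.

Lemma dirichlet_Re_Im (a : nat -> R) (sg t : R) (N : nat) :
  dirichlet a (sg, t) N =
  (sum_n_m (fun n => coeff a sg n * cos (t * ln (INR n))) 1 N,
   - sum_n_m (fun n => coeff a sg n * sin (t * ln (INR n))) 1 N).
Proof.
induction N as [|N IH].
- unfold dirichlet; rewrite !sum_n_m_zero by lia.
  apply injective_projections; [reflexivity|symmetry; apply Ropp_0].
- rewrite dirichlet_S, IH, !sum_n_m_RS.
  unfold coeff, Rcpow; generalize (INR (S N)); intros x.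
  change (Re (- (sg, t))%C) with (- sg); change (Im (- (sg, t))%C) with (- t).
  replace (- t * ln x) with (- (t * ln x)) by ring.
  rewrite cos_neg, sin_neg; apply injective_projections; simpl; ring.
Qed.

Lemma Cmod_sqr (z : C) : Cmod z ^ 2 = Re z ^ 2 + Im z ^ 2.
Proof. unfold Cmod; rewrite pow2_sqrt; [reflexivity|simpl; nra]. Qed.

Lemma Cmod_dirichlet_sqr_S (a : nat -> R) (sg t : R) (N : nat) :
  Cmod (dirichlet a (sg, t) (S N)) ^ 2 =
  Cmod (dirichlet a (sg, t) N) ^ 2 + coeff a sg (S N) ^ 2
  + sum_n_m (fun i => 2 * coeff a sg (S N) * coeff a sg i
      * cos (t * (ln (INR (S N)) - ln (INR i)))) 1 N.
Proof.
assert (E : sum_n_m (fun i => 2 * coeff a sg (S N) * coeff a sg i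
      * cos (t * (ln (INR (S N)) - ln (INR i)))) 1 N
  = 2 * coeff a sg (S N) * cos (t * ln (INR (S N)))
    * sum_n_m (fun n => coeff a sg n * cos (t * ln (INR n))) 1 N
  + 2 * coeff a sg (S N) * sin (t * ln (INR (S N)))
    * sum_n_m (fun n => coeff a sg n * sin (t * ln (INR n))) 1 N).
{ rewrite <- !sum_n_m_Rmult_l, <- sum_n_m_Rplus.
  apply sum_n_m_ext; intros i.
  rewrite Rmult_minus_distr_l, cos_minus.
  match goal with |- ?x = ?y => change (@eq R x y) end; ring. }
rewrite E, !Cmod_sqr, !dirichlet_Re_Im, !sum_n_m_RS.
unfold Re, Im; cbn [fst snd]; clear E.
generalize (sum_n_m (fun n => coeff a sg n * cos (t * ln (INR n))) 1 N)
  (sum_n_m (fun n => coeff a sg n * sin (t * ln (INR n))) 1 N) (coeff a sg (S N)).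
intros A B c.
pose proof (sin2_cos2 (t * ln (INR (S N)))) as H; unfold Rsqr in H.
generalize dependent (sin (t * ln (INR (S N)))).
generalize dependent (cos (t * ln (INR (S N)))).
intros x y H.
replace (c ^ 2) with (c ^ 2 * (y * y + x * x)) by (rewrite H; ring); ring.
Qed.

Lemma is_RInt_sum_cos (c la : nat -> R) (T : R) (N : nat) :
  (forall i, (1 <= i <= N)%nat -> 0 < la i) ->
  exists I, is_RInt (fun t => sum_n_m (fun i => c i * cos (t * la i)) 1 N) 1 T I
    /\ Rabs I <= sum_n_m (fun i => Rabs (c i) * (2 / la i)) 1 N.
Proof.
induction N as [|N IH]; intros H.
- exists 0; split.
  + apply is_RInt_ext with (fun _ => 0).
    { intros x _; now rewrite sum_n_m_zero by lia. }
    pose proof (is_RInt_const 1 T 0) as H0.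
    change (scal (T - 1) 0) with ((T - 1) * 0) in H0; now rewrite Rmult_0_r in H0.
  + rewrite Rabs_R0, sum_n_m_zero by lia; apply Rle_refl.
- destruct IH as [I [HI HB]]; [intros; apply H; lia|].
  pose proof (H (S N) ltac:(lia)) as Hl.
  exists (I + c (S N) * ((sin (T * la (S N)) - sin (1 * la (S N))) / la (S N))); split.
  + apply is_RInt_ext with (fun t => plus (sum_n_m (fun i => c i * cos (t * la i)) 1 N)
      (c (S N) * cos (t * la (S N)))).
    { intros x _; now rewrite sum_n_m_RS. }
    apply (is_RInt_plus (V := R_NormedModule)); [exact HI|].
    replace (c (S N) * ((sin (T * la (S N)) - sin (1 * la (S N))) / la (S N)))
      with (minus (c (S N) / la (S N) * sin (T * la (S N)))
                  (c (S N) / la (S N) * sin (1 * la (S N))))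
      by (unfold minus, plus, opp; simpl; field; lra).
    apply (is_RInt_derive (fun t => c (S N) / la (S N) * sin (t * la (S N)))).
    * intros x _; auto_derive; [easy|field; lra].
    * intros x _; apply (ex_derive_continuous (fun t => c (S N) * cos (t * la (S N)))).
      auto_derive; easy.
  + rewrite sum_n_m_RS; eapply Rle_trans; [apply Rabs_triang|].
    apply Rplus_le_compat; [exact HB|].
    rewrite Rabs_mult; apply Rmult_le_compat_l; [apply Rabs_pos|].
    unfold Rdiv; rewrite Rabs_mult, (Rabs_pos_eq (/ _))
      by (apply Rlt_le, Rinv_0_lt_compat, Hl).
    apply Rmult_le_compat_r; [apply Rlt_le, Rinv_0_lt_compat, Hl|].
    pose proof (SIN_bound (T * la (S N))); pose proof (SIN_bound (1 * la (S N))).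
    apply Rabs_le; lra.
Qed.

(* Bounds the off-diagonal terms when the coefficients are bounded by 1. *)
Definition off_diagonal (sg : R) (N : nat) : R :=
  sum_n_m (fun j => sum_n_m (fun i => 4 * (Rpower (INR j) (- sg) * Rpower (INR i) (- sg))
    * (/ (ln (INR j) - ln (INR i)))) 1 (j - 1)) 1 N.

Lemma ln_diff_pos (i j : nat) : (1 <= i < j)%nat -> 0 < ln (INR j) - ln (INR i).
Proof.
intros H; assert (ln (INR i) < ln (INR j)); [|lra].
apply ln_increasing; [apply lt_0_INR; lia|apply lt_INR; lia].
Qed.

(** Induction on the length: a new term adds its own square and cosines of the positive frequencies
    ln (N+1) - ln i, whose integrals are bounded independently of T. *)
Lemma mean_square (a : nat -> R) (sg T c : R) (N : nat) : 1 <= T ->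
  (forall n, Rabs (a n) <= c) ->
  exists I, is_RInt (fun t => Cmod (dirichlet a (sg, t) N) ^ 2) 1 T I
    /\ Rabs (I - (T - 1) * energy a sg N) <= c ^ 2 * off_diagonal sg N.
Proof.
intros HT Ha; unfold energy, off_diagonal.
induction N as [|N [I [HI HB]]].
- exists 0; split.
  + apply is_RInt_ext with (fun _ => 0).
    { intros x _; unfold dirichlet; rewrite sum_n_m_zero by lia.
      change zero with (RtoC 0); rewrite Cmod_0; symmetry; apply pow_i; lia. }
    pose proof (is_RInt_const 1 T 0) as H0.
    change (scal (T - 1) 0) with ((T - 1) * 0) in H0; now rewrite Rmult_0_r in H0.
  + rewrite !sum_n_m_zero by lia; change zero with 0.
    rewrite !Rmult_0_r, Rminus_0_r, Rabs_R0; apply Rle_refl.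
- destruct (is_RInt_sum_cos (fun i => 2 * coeff a sg (S N) * coeff a sg i)
    (fun i => ln (INR (S N)) - ln (INR i)) T N) as [J [HJ HJB]].
  { intros i Hi; apply ln_diff_pos; lia. }
  exists (I + (T - 1) * coeff a sg (S N) ^ 2 + J); split.
  + eapply is_RInt_ext; [intros x _; symmetry; apply Cmod_dirichlet_sqr_S|].
    apply (is_RInt_plus (V := R_NormedModule)); [|exact HJ].
    apply (is_RInt_plus (V := R_NormedModule)); [exact HI|].
    apply (is_RInt_const (V := R_NormedModule)).
  + rewrite !sum_n_m_RS.
    replace (I + (T - 1) * coeff a sg (S N) ^ 2 + J - (T - 1) *
      (sum_n_m (fun n => coeff a sg n ^ 2) 1 N + coeff a sg (S N) ^ 2))
      with ((I - (T - 1) * sum_n_m (fun n => coeff a sg n ^ 2) 1 N) + J) by ring.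
    eapply Rle_trans; [apply Rabs_triang|].
    rewrite Rmult_plus_distr_l; apply Rplus_le_compat; [exact HB|].
    eapply Rle_trans; [exact HJB|].
    replace (S N - 1)%nat with N by lia.
    rewrite <- sum_n_m_Rmult_l; apply sum_le_loc; intros i Hi.
    pose proof (ln_diff_pos i (S N) ltac:(lia)) as Hl.
    unfold coeff; rewrite !Rabs_mult, (Rabs_pos_eq 2),
      !(Rabs_pos_eq (Rpower _ _)) by (lra || apply Rlt_le, Rpower_pos).
    replace (c ^ 2 * (4 * (Rpower (INR (S N)) (- sg) * Rpower (INR i) (- sg))
      * / (ln (INR (S N)) - ln (INR i))))
      with ((2 * (c * Rpower (INR (S N)) (- sg)) * (c * Rpower (INR i) (- sg)))
      * (2 / (ln (INR (S N)) - ln (INR i)))) by (field; lra).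
    apply Rmult_le_compat_r; [apply Rlt_le, Rdiv_lt_0_compat; lra|].
    pose proof (Rpower_pos (INR (S N)) (- sg)); pose proof (Rpower_pos (INR i) (- sg)).
    pose proof (Ha (S N)); pose proof (Ha i).
    pose proof (Rabs_pos (a (S N))); pose proof (Rabs_pos (a i)).
    apply Rmult_le_compat; nra.
Qed.

Lemma sum_Rpower_le' (th : R) (N : nat) : 0 < th <= 1 -> (1 <= N)%nat ->
  sum_n_m (fun n => Rpower (INR n) (th - 1)) 1 N <= Rpower (INR N) th / th.
Proof.
intros Hth HN; eapply Rle_trans; [now apply sum_Rpower_le|].
assert (1 <= / th) by (rewrite <- Rinv_1; apply Rinv_le_contravar; lra).
unfold Rdiv; lra.
Qed.

(** A harmonic sum read backwards; 1/m <= m^(ta-1) trades its logarithm for a small power. *)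
Lemma sum_inv_diff_le (ta : R) (j : nat) : 0 < ta <= 1 -> (1 <= j)%nat ->
  sum_n_m (fun i => / (INR (S j) - INR i)) 1 j <= Rpower (INR j) ta / ta.
Proof.
intros Hta Hj; eapply Rle_trans; [|now apply sum_Rpower_le'].
clear Hj; induction j as [|j IH].
- rewrite !sum_n_m_zero by lia; apply Rle_refl.
- rewrite sum_Sn_m, <- sum_n_m_S, sum_n_m_RS by lia; rewrite Rplus_comm.
  apply Rplus_le_compat.
  + eapply Rle_trans; [|exact IH].
    apply sum_le_loc; intros i _; right; f_equal; rewrite (S_INR i), (S_INR (S j)); ring.
  + replace (INR (S (S j)) - INR 1) with (INR (S j)) by (rewrite (S_INR (S j)); simpl; ring).
    rewrite <- (Rpower_1 (INR (S j))) at 1 by apply INR_S_pos.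
    rewrite <- Rpower_Ropp; apply Rle_Rpower; [apply INR_ge_one; lia|lra].
Qed.

(** The exponent 1 - ta is below 1 exactly because sg > 1/2, so the cross terms are o(N) and no
    finer inequality of Hilbert type is called for. *)
Lemma off_diagonal_le (sg : R) (N : nat) : 1 / 2 < sg < 1 -> (1 <= N)%nat ->
  let ta := sg - 1 / 2 in
  off_diagonal sg N <= 4 * (/ (1 - sg) + / ta) / (1 - ta) * Rpower (INR N) (1 - ta).
Proof.
intros Hs HN ta; assert (Hta : 0 < ta < 1 / 2) by (unfold ta; lra).
set (c := 4 * (/ (1 - sg) + / ta)).
assert (Hc : 0 < c).
{ assert (0 < / (1 - sg)) by (apply Rinv_0_lt_compat; lra).
  assert (0 < / ta) by (apply Rinv_0_lt_compat; lra).
  unfold c; lra. }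
replace (c / (1 - ta) * Rpower (INR N) (1 - ta)) with (c * (Rpower (INR N) (1 - ta) / (1 - ta)))
  by (field; lra).
apply Rle_trans with (c * sum_n_m (fun n => Rpower (INR n) (1 - ta - 1)) 1 N);
  [|apply Rmult_le_compat_l; [lra|apply sum_Rpower_le'; [lra|easy]]].
unfold off_diagonal; rewrite <- sum_n_m_Rmult_l; apply sum_le_loc; intros j Hj.
destruct j as [|[|j]]; [lia| |].
{ rewrite sum_n_m_zero by lia; change zero with 0.
  apply Rmult_le_pos; [lra|apply Rlt_le, Rpower_pos]. }
replace (S (S j) - 1)%nat with (S j) by lia.
set (x := INR (S (S j))).
assert (Hx : 1 <= x) by (apply INR_ge_one; lia).
apply Rle_trans with (sum_n_m (fun i => 4 * Rpower x (- sg) * Rpower (INR i) (1 - sg - 1)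
  + 4 * Rpower x (1 - 2 * sg) * / (x - INR i)) 1 (S j)).
- apply sum_le_loc; intros i Hi.
  assert (Hi1 : 1 <= INR i) by (apply INR_ge_one; lia).
  assert (Hix : INR i < x) by (apply lt_INR; lia).
  replace (1 - sg - 1) with (- sg) by ring.
  set (p := Rpower x (- sg)); set (q := Rpower (INR i) (- sg)).
  assert (Hp : 0 < p) by apply Rpower_pos; assert (Hq : 0 < q) by apply Rpower_pos.
  pose proof (ln_diff_pos i (S (S j)) ltac:(lia)) as Hl; fold x in Hl.
  assert (L : (x - INR i) / x <= ln x - ln (INR i)).
  { pose proof (ln_le_minus_one (INR i / x) ltac:(apply Rdiv_lt_0_compat; lra)) as H.
    rewrite ln_div in H by lra.
    replace ((x - INR i) / x) with (1 - INR i / x) by (field; lra); lra. }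
  (* From ln (x/i) >= (x-i)/x one gets 1/ln (x/i) <= x/(x-i) = 1 + i/(x-i): the first part controls
     pairs far from the diagonal, the second those near it. *)
  assert (L2 : / (ln x - ln (INR i)) <= 1 + INR i * / (x - INR i)).
  { replace (1 + INR i * / (x - INR i)) with (/ ((x - INR i) / x)) by (field; lra).
    apply Rinv_le_contravar; [apply Rdiv_lt_0_compat; lra|exact L]. }
  assert (L3 : q * INR i <= p * x).
  { assert (E : forall y, 0 < y -> Rpower y (- sg) * y = Rpower y (1 - sg)).
    { intros y Hy; unfold Rminus; rewrite Rplus_comm, Rpower_plus, Rpower_1; easy. }
    unfold p, q; rewrite !E by lra.
    apply Rle_Rpower_l; lra. }
  assert (L4 : Rpower x (1 - 2 * sg) = p * (p * x)).
  { replace (1 - 2 * sg) with (- sg + (- sg + 1)) by ring.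
    rewrite !Rpower_plus, Rpower_1 by lra; reflexivity. }
  rewrite L4.
  assert (0 < / (x - INR i)) by (apply Rinv_0_lt_compat; lra).
  apply Rle_trans with (4 * (p * q) * (1 + INR i * / (x - INR i))).
  + apply Rmult_le_compat_l; [nra|exact L2].
  + replace (4 * (p * q) * (1 + INR i * / (x - INR i)))
      with (4 * p * q + 4 * p * (q * INR i) * / (x - INR i)) by ring.
    apply Rplus_le_compat_l, Rmult_le_compat_r; nra.
- rewrite sum_n_m_Rplus, !sum_n_m_Rmult_l.
  pose proof (sum_Rpower_le' (1 - sg) (S j) ltac:(lra) ltac:(lia)) as S1.
  pose proof (sum_inv_diff_le ta (S j) ltac:(lra) ltac:(lia)) as S2.
  fold x in S2.
  assert (Hjx : 0 < INR (S j) <= x).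
  { split; [apply INR_S_pos|]; apply le_INR; lia. }
  assert (M1 : Rpower (INR (S j)) (1 - sg) <= Rpower x (1 - sg)) by (apply Rle_Rpower_l; lra).
  assert (M2 : Rpower (INR (S j)) ta <= Rpower x ta) by (apply Rle_Rpower_l; lra).
  apply Rle_trans with (4 * Rpower x (- sg) * (Rpower x (1 - sg) / (1 - sg))
    + 4 * Rpower x (1 - 2 * sg) * (Rpower x ta / ta)).
  + apply Rplus_le_compat; apply Rmult_le_compat_l.
    * pose proof (Rpower_pos x (- sg)); lra.
    * eapply Rle_trans; [exact S1|]; apply Rmult_le_compat_r; [|exact M1].
      apply Rlt_le, Rinv_0_lt_compat; lra.
    * pose proof (Rpower_pos x (1 - 2 * sg)); lra.
    * eapply Rle_trans; [exact S2|]; apply Rmult_le_compat_r; [|exact M2].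
      apply Rlt_le, Rinv_0_lt_compat; lra.
  + replace (4 * Rpower x (- sg) * (Rpower x (1 - sg) / (1 - sg)))
      with (4 * (/ (1 - sg) * (Rpower x (- sg) * Rpower x (1 - sg)))) by (field; lra).
    replace (4 * Rpower x (1 - 2 * sg) * (Rpower x ta / ta))
      with (4 * (/ ta * (Rpower x (1 - 2 * sg) * Rpower x ta))) by (field; lra).
    rewrite <- !Rpower_plus.
    replace (1 - 2 * sg + ta) with (1 - ta - 1) by (unfold ta; field).
    assert (Rpower x (- sg + (1 - sg)) <= Rpower x (1 - ta - 1))
      by (apply Rle_Rpower; unfold ta; lra).
    assert (0 < / (1 - sg)) by (apply Rinv_0_lt_compat; lra).
    unfold c; nra.
Qed.

(** Square the pointwise inequality, integrate over [1, T] with T = N/K, divide by T - 1 and let N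
    grow: the cross terms vanish in the limit and the energies remain. The 2 on the right comes from
    (B + e)^2 <= 2 B^2 + 2 e^2. *)
Lemma energy_le_of_Cmod_le (a b : nat -> R) (sg c m K La B : R) :
  1 / 2 < sg < 1 -> 0 <= m -> 1 <= K ->
  (forall n, Rabs (a n) <= c) -> (forall n, Rabs (b n) <= c) ->
  (forall eps, 0 < eps -> exists N0 : nat, forall (N : nat) (t : R),
     (N0 <= N)%nat -> 1 <= t -> K * t <= INR N ->
     m * Cmod (dirichlet a (sg, t) N) <= Cmod (dirichlet b (sg, t) N) + eps) ->
  (exists N0, forall N, (N0 <= N)%nat -> La <= energy a sg N) ->
  (forall N, energy b sg N <= B) ->
  m ^ 2 * La <= 2 * B.
Proof.
intros Hs Hm HK Ha Hb Hab [N1 HLa] HB.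
apply le_epsilon; intros eps Heps.
(* As e1 <= 1, also e1^2 <= eps/4, so the approximation error uses up half of [eps]; the cross terms
   take the other half. *)
set (e1 := Rmin 1 (eps / 4)).
assert (He1 : 0 < e1 /\ e1 <= 1 /\ e1 <= eps / 4).
{ unfold e1; split; [apply Rmin_glb_lt; lra|split; [apply Rmin_l|apply Rmin_r]]. }
destruct (Hab e1 ltac:(lra)) as [N0 HN0].
set (ta := sg - 1 / 2).
set (D := 4 * (/ (1 - sg) + / ta) / (1 - ta)).
(* Cross terms enter with weight m^2 from [a] and 2 from [b]; the factor 2K converts N into T - 1,
   which is at least N/(2K). *)
set (E := (m ^ 2 + 2) * c ^ 2 * D * (2 * K)).
assert (Hl : is_lim_seq (fun N => E * Rpower (INR N) (- ta)) 0).
{ replace (Finite 0) with (Rbar_mult E 0) by (simpl; now rewrite Rmult_0_r).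
  apply is_lim_seq_scal_l, Rpower_lim_0; unfold ta; lra. }
apply is_lim_seq_spec in Hl.
destruct (Hl (mkposreal (eps / 2) ltac:(lra))) as [N2 HN2]; simpl in HN2.
destruct (nfloor_ex (2 * K) ltac:(lra)) as [k [_ Hk]].
set (N := (N0 + N1 + N2 + S k)%nat).
specialize (HN2 N ltac:(unfold N; lia)).
rewrite Rminus_0_r in HN2; apply Rabs_lt_between in HN2.
assert (HNK : 2 * K <= INR N).
{ apply Rle_trans with (INR (S k)); [rewrite S_INR; lra|apply le_INR; unfold N; lia]. }
set (T := INR N / K).
assert (HT : INR N / (2 * K) <= T - 1).
{ unfold T; apply Rmult_le_reg_r with (2 * K); [lra|]; field_simplify; lra. }
assert (HT1 : 1 <= T - 1).
{ eapply Rle_trans; [|exact HT]; apply Rmult_le_reg_r with (2 * K); [lra|]; field_simplify; lra. }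
destruct (mean_square a sg T c N ltac:(lra) Ha) as [Ia [HIa HEa]].
destruct (mean_square b sg T c N ltac:(lra) Hb) as [Ib [HIb HEb]].
assert (HI : m ^ 2 * Ia <= 2 * Ib + 2 * e1 ^ 2 * (T - 1)).
{ apply (is_RInt_le (fun t => m ^ 2 * Cmod (dirichlet a (sg, t) N) ^ 2)
    (fun t => 2 * Cmod (dirichlet b (sg, t) N) ^ 2 + 2 * e1 ^ 2) 1 T); [lra| | |].
  - exact (is_RInt_scal (V := R_NormedModule) _ _ _ (m ^ 2) _ HIa).
  - replace (2 * e1 ^ 2 * (T - 1)) with (scal (T - 1) (2 * e1 ^ 2))
      by (unfold scal; simpl; unfold mult; simpl; ring).
    apply (is_RInt_plus (V := R_NormedModule)); [|apply (is_RInt_const (V := R_NormedModule))].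
    exact (is_RInt_scal (V := R_NormedModule) _ _ _ 2 _ HIb).
  - intros t Ht.
    assert (H : m * Cmod (dirichlet a (sg, t) N) <= Cmod (dirichlet b (sg, t) N) + e1).
    { apply HN0; [unfold N; lia|lra|].
      replace (INR N) with (K * T) by (unfold T; field; lra).
      apply Rmult_le_compat_l; lra. }
    pose proof (Cmod_ge_0 (dirichlet a (sg, t) N)).
    pose proof (Cmod_ge_0 (dirichlet b (sg, t) N)).
    set (A := Cmod (dirichlet a (sg, t) N)) in *.
    set (B' := Cmod (dirichlet b (sg, t) N)) in *.
    assert (0 <= m * A) by (apply Rmult_le_pos; lra).
    assert ((m * A) ^ 2 <= (B' + e1) ^ 2) by (apply pow_incr; lra).
    pose proof (pow2_ge_0 (B' - e1)); nra. }
assert (Hoff : (m ^ 2 + 2) * (c ^ 2 * off_diagonal sg N) <= eps / 2 * (T - 1)).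
{ assert (HN1' : (1 <= N)%nat) by (unfold N; lia).
  assert (Ho : off_diagonal sg N <= D * Rpower (INR N) (1 - ta))
    by exact (off_diagonal_le sg N Hs HN1').
  assert (E2 : Rpower (INR N) (1 - ta) = INR N * Rpower (INR N) (- ta)).
  { unfold Rminus; rewrite Rpower_plus, Rpower_1; [easy|apply lt_0_INR; lia]. }
  rewrite E2 in Ho.
  apply Rle_trans with ((m ^ 2 + 2) * (c ^ 2 * (D * (INR N * Rpower (INR N) (- ta))))).
  - apply Rmult_le_compat_l; [nra|]; apply Rmult_le_compat_l; [nra|exact Ho].
  - replace ((m ^ 2 + 2) * (c ^ 2 * (D * (INR N * Rpower (INR N) (- ta)))))
      with (E * Rpower (INR N) (- ta) * (INR N / (2 * K))) by (unfold E; field; lra).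
    apply Rle_trans with (eps / 2 * (INR N / (2 * K))).
    + apply Rmult_le_compat_r; [|lra].
      apply Rmult_le_pos; [apply pos_INR|apply Rlt_le, Rinv_0_lt_compat; lra].
    + apply Rmult_le_compat_l; lra. }
specialize (HLa N ltac:(unfold N; lia)); specialize (HB N).
apply Rabs_le_between in HEa; apply Rabs_le_between in HEb.
assert (Hfin : (T - 1) * (m ^ 2 * La) <= (T - 1) * (2 * B + eps)).
{ assert (m ^ 2 * ((T - 1) * energy a sg N - c ^ 2 * off_diagonal sg N) <= m ^ 2 * Ia)
    by (apply Rmult_le_compat_l; nra).
  assert (m ^ 2 * ((T - 1) * La) <= m ^ 2 * ((T - 1) * energy a sg N))
    by (apply Rmult_le_compat_l; nra).
  assert ((T - 1) * energy b sg N <= (T - 1) * B) by (apply Rmult_le_compat_l; lra).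
  assert (e1 ^ 2 <= eps / 4) by nra.
  assert (2 * e1 ^ 2 * (T - 1) <= eps / 2 * (T - 1)) by (apply Rmult_le_compat_r; lra).
  lra. }
apply Rmult_le_reg_l in Hfin; lra.
Qed.

(** * Euler factors acting on coefficients *)

Definition dilate (p : nat) (a : nat -> R) (n : nat) : R :=
  if Nat.eqb (n mod p) 0 then a (n / p)%nat else 0.

(* The coefficients of (1 - y p^(-s)) * sum a(n) n^(-s). *)
Definition twist (p : nat) (y : R) (a : nat -> R) (n : nat) : R :=
  a n - y * dilate p a n.

Lemma dilate_mul (p m : nat) (a : nat -> R) : (1 <= p)%nat -> dilate p a (p * m) = a m.
Proof.
intros Hp; unfold dilate; rewrite Nat.mul_comm, Nat.Div0.mod_mul; simpl.
now rewrite Nat.div_mul by lia.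
Qed.

Lemma dilate_not (p n : nat) (a : nat -> R) : (1 <= p)%nat -> ~ Nat.divide p n ->
  dilate p a n = 0.
Proof.
intros Hp H; unfold dilate; destruct (Nat.eqb_spec (n mod p) 0) as [E|]; [|easy].
destruct H; apply Nat.Lcm0.mod_divide, E.
Qed.

Lemma divide_cases (p n : nat) : (1 <= p)%nat ->
  (exists m, n = (p * m)%nat) \/ ~ Nat.divide p n.
Proof.
intros Hp; destruct (Nat.eq_dec (n mod p) 0) as [E|E].
- left; apply Nat.Lcm0.mod_divide in E; destruct E as [m ->]; exists m; lia.
- right; intros H; apply E, Nat.Lcm0.mod_divide, H.
Qed.

Lemma div_S_divide (p m N : nat) : (1 <= p)%nat -> S N = (p * m)%nat ->
  (N / p)%nat = (m - 1)%nat.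
Proof.
intros Hp Hm; symmetry; apply (Nat.div_unique N p (m - 1) (p - 1)); [lia|].
destruct m; [lia|]; nia.
Qed.

Lemma div_S_not_divide (p N : nat) : (1 <= p)%nat -> ~ Nat.divide p (S N) ->
  (S N / p)%nat = (N / p)%nat.
Proof.
intros Hp Hn; apply (Nat.div_unique N p (S N / p) (S N mod p - 1)).
- pose proof (Nat.mod_upper_bound (S N) p ltac:(lia)); lia.
- assert (S N mod p <> 0)%nat by (intros E; apply Hn, Nat.Lcm0.mod_divide, E).
  pose proof (Nat.div_mod_eq (S N) p); lia.
Qed.

Lemma sum_dilate (p : nat) (a : nat -> R) (N : nat) : (1 <= p)%nat ->
  sum_n_m (dilate p a) 1 N = sum_n_m a 1 (N / p).
Proof.
intros Hp; induction N as [|N IH].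
- rewrite Nat.Div0.div_0_l, !sum_n_m_zero by lia; reflexivity.
- rewrite sum_n_m_RS, IH.
  destruct (divide_cases p (S N) Hp) as [[m Hm]|Hn].
  + pose proof (div_S_divide p m N Hp Hm) as HN.
    rewrite Hm, dilate_mul, HN, (Nat.mul_comm p m), Nat.div_mul by lia.
    destruct m as [|m]; [lia|].
    rewrite sum_n_m_RS; replace (S m - 1)%nat with m by lia; reflexivity.
  + rewrite dilate_not, Rplus_0_r, div_S_not_divide by easy; reflexivity.
Qed.

Lemma dirichlet_dilate (p : nat) (a : nat -> R) (s : C) (N : nat) : (1 <= p)%nat ->
  dirichlet (dilate p a) s N = (Rcpow (INR p) (- s) * dirichlet a s (N / p))%C.
Proof.
intros Hp; induction N as [|N IH].
- rewrite Nat.Div0.div_0_l; unfold dirichlet; rewrite !sum_n_m_zero by lia.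
  change zero with (RtoC 0); ring.
- rewrite dirichlet_S, IH.
  destruct (divide_cases p (S N) Hp) as [[m Hm]|Hn].
  + pose proof (div_S_divide p m N Hp Hm) as HN.
    rewrite Hm, dilate_mul, HN, (Nat.mul_comm p m), Nat.div_mul by lia.
    destruct m as [|m]; [lia|].
    replace (S m - 1)%nat with m by lia.
    rewrite Nat.mul_comm, mult_INR, Rcpow_mult_l, dirichlet_S by (apply lt_0_INR; lia).
    ring.
  + rewrite dilate_not, div_S_not_divide by easy; ring.
Qed.

Lemma dirichlet_twist (p : nat) (y : R) (a : nat -> R) (s : C) (N : nat) : (1 <= p)%nat ->
  dirichlet (twist p y a) s N
  = (dirichlet a s N - y * Rcpow (INR p) (- s) * dirichlet a s (N / p))%C.
Proof.
intros Hp; rewrite <- Cmult_assoc, <- dirichlet_dilate by easy.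
induction N as [|N IH].
- unfold dirichlet; rewrite !sum_n_m_zero by lia; change zero with (RtoC 0); ring.
- rewrite !dirichlet_S, IH; unfold twist; rewrite RtoC_minus, RtoC_mult; ring.
Qed.

(** The approximation is uniform over all t from 1 up to N/K. A constant K is allowed because
    multiplication by an Euler factor brings in the shorter length N/p. *)
Definition approximated (sg : R) (f : R -> C) (a : nat -> R) : Prop :=
  exists K, 1 <= K /\ forall eps, 0 < eps -> exists N0 : nat, forall (N : nat) (t : R),
    (N0 <= N)%nat -> 1 <= t -> K * t <= INR N ->
    Cmod (f t - dirichlet a (sg, t) N)%C <= eps.

Lemma approximated_twist (sg : R) (f : R -> C) (a : nat -> R) (p : nat) (y : R) :
  0 < sg -> (1 <= p)%nat -> approximated sg f a ->
  approximated sg (fun t => (1 - y * Rcpow (INR p) (- (sg, t))) * f t)%C (twist p y a).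
Proof.
intros Hs Hp [K [HK H]].
pose proof (INR_ge_one p Hp) as HP.
(* Rounding N/p down loses less than 1, and t >= 1 lets the extra 1 in K + 1 absorb this loss. *)
exists (INR p * (K + 1)); split; [nra|].
intros eps Heps.
pose proof (Rabs_pos y) as Hy.
destruct (H (eps / (1 + Rabs y))) as [N0 HN0]; [apply Rdiv_lt_0_compat; lra|].
exists (p * N0)%nat; intros N t HN Ht HKt.
assert (HNp : (N0 <= N / p)%nat).
{ apply Nat.div_le_lower_bound; [lia|exact HN]. }
assert (HKp : K * t <= INR (N / p)).
{ assert (HNr : INR N <= INR p * (INR (N / p) + 1)).
  { rewrite <- S_INR, <- mult_INR; apply le_INR.
    pose proof (Nat.mul_succ_div_gt N p ltac:(lia)); lia. }
  assert (INR p <= INR p * t) by nra.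
  apply Rmult_le_reg_l with (INR p); lra. }
assert (HKN : K * t <= INR N).
{ eapply Rle_trans; [exact HKp|apply le_INR, Nat.Div0.div_le_upper_bound; nia]. }
pose proof (HN0 N t ltac:(nia) Ht HKN) as E1.
pose proof (HN0 (N / p)%nat t HNp Ht HKp) as E2.
rewrite dirichlet_twist by easy.
set (r := Rcpow (INR p) (- (sg, t))).
replace ((1 - y * r) * f t - (dirichlet a (sg, t) N - y * r * dirichlet a (sg, t) (N / p)))%C
  with ((f t - dirichlet a (sg, t) N)
        + - (y * r * (f t - dirichlet a (sg, t) (N / p))))%C by ring.
eapply Rle_trans; [apply Cmod_triangle|].
rewrite Cmod_opp, !Cmod_mult, Cmod_R.
assert (Hr : 0 < Cmod r <= 1).
{ unfold r; rewrite Cmod_Rcpow; change (Re (- (sg, t))%C) with (- sg).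
  split; [apply Rpower_pos|].
  rewrite <- (Rpower_O (INR p)) by lra; apply Rle_Rpower; lra. }
apply Rle_trans with (eps / (1 + Rabs y) + Rabs y * 1 * (eps / (1 + Rabs y))).
- apply Rplus_le_compat; [exact E1|].
  apply Rmult_le_compat; [nra|apply Cmod_ge_0| |exact E2].
  apply Rmult_le_compat_l; lra.
- right; field; lra.
Qed.

Definition bounded_coefficients (a : nat -> R) : Prop := exists c, forall n, Rabs (a n) <= c.

Lemma bounded_twist (p : nat) (y : R) (a : nat -> R) :
  bounded_coefficients a -> bounded_coefficients (twist p y a).
Proof.
intros [c Hc]; exists (c + Rabs y * c); intros n; unfold twist.
assert (H : Rabs (dilate p a n) <= c).
{ unfold dilate; destruct Nat.eqb; [apply Hc|].
  rewrite Rabs_R0; eapply Rle_trans; [apply Rabs_pos|apply (Hc 0%nat)]. }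
eapply Rle_trans; [apply Rabs_triang|].
rewrite Rabs_Ropp, Rabs_mult.
apply Rplus_le_compat; [apply Hc|apply Rmult_le_compat_l; [apply Rabs_pos|exact H]].
Qed.

(** Alternating signs are invariant under odd dilations, and the unit sequence [delta1] vanishes on
    multiples of any q >= 2. Either property at q survives twists at numbers coprime to q, so the
    Euler factors can be treated one at a time. *)
Definition invariant (q : nat) (a : nat -> R) : Prop :=
  forall n, (1 <= n)%nat -> a (q * n)%nat = a n.

Definition vanishing (q : nat) (a : nat -> R) : Prop :=
  forall n, (1 <= n)%nat -> a (q * n)%nat = 0.

Lemma dilate_coprime (p q n : nat) (a : nat -> R) : (1 <= p)%nat -> (1 <= q)%nat ->
  Nat.gcd p q = 1%nat -> (1 <= n)%nat ->
  dilate p a (q * n) = dilate p (fun m => a (q * m)%nat) n.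
Proof.
intros Hp Hq Hg Hn; destruct (divide_cases p n Hp) as [[m ->]|Hd].
- rewrite dilate_mul by easy.
  replace (q * (p * m))%nat with (p * (q * m))%nat by lia; now rewrite dilate_mul.
- rewrite !dilate_not; [easy|easy|easy|easy|].
  intros H; apply Hd, (Nat.gauss p q n); [exact H|exact Hg].
Qed.

Lemma dilate_ext (p n : nat) (a b : nat -> R) : (1 <= p)%nat -> (1 <= n)%nat ->
  (forall m, (1 <= m)%nat -> a m = b m) -> dilate p a n = dilate p b n.
Proof.
intros Hp Hn H; destruct (divide_cases p n Hp) as [[m ->]|Hd].
- rewrite !dilate_mul by easy; apply H; nia.
- now rewrite !dilate_not.
Qed.

Lemma invariant_twist (p q : nat) (y : R) (a : nat -> R) : (1 <= p)%nat -> (1 <= q)%nat ->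
  Nat.gcd p q = 1%nat -> invariant q a -> invariant q (twist p y a).
Proof.
intros Hp Hq Hg H n Hn; unfold twist.
rewrite dilate_coprime, H by easy; f_equal; f_equal.
now apply dilate_ext.
Qed.

Lemma vanishing_twist (p q : nat) (y : R) (a : nat -> R) : (1 <= p)%nat -> (1 <= q)%nat ->
  Nat.gcd p q = 1%nat -> vanishing q a -> vanishing q (twist p y a).
Proof.
intros Hp Hq Hg H n Hn; unfold twist.
rewrite dilate_coprime, H, (dilate_ext p n _ (fun _ => 0)) by easy.
unfold dilate; destruct Nat.eqb; ring.
Qed.

Lemma twist_invariant (p n : nat) (a : nat -> R) : (1 <= p)%nat -> (1 <= n)%nat ->
  invariant p a ->
  (Nat.divide p n /\ twist p 1 a n = 0) \/ (~ Nat.divide p n /\ twist p 1 a n = a n).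
Proof.
intros Hp Hn H; unfold twist; destruct (divide_cases p n Hp) as [[m ->]|Hd].
- left; split; [exists m; lia|]; rewrite dilate_mul, H by nia; ring.
- right; split; [easy|]; rewrite dilate_not by easy; ring.
Qed.

(* The factor p^sg - 1 steers p^(-it) towards -1, where |1 - p^(-sg-it)| is largest. *)
Definition mollify_step (sg : R) (a : nat -> R) (p : nat) : nat -> R :=
  twist p (Rpower (INR p) sg) (twist p 1 a).

Lemma Rpower_neg_cancel (x a : R) : Rpower x a * Rpower x (- a) = 1.
Proof.
rewrite <- Rpower_plus, Rplus_opp_r; unfold Rpower; rewrite Rmult_0_l; apply exp_0.
Qed.

Lemma Rpower_mult_INR (p m : nat) (a : R) : (1 <= p)%nat -> (1 <= m)%nat ->
  Rpower (INR (p * m)) a = Rpower (INR p) a * Rpower (INR m) a.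
Proof.
intros Hp Hm; rewrite mult_INR, Rpower_mult_distr; [easy| |]; apply lt_0_INR; lia.
Qed.

Lemma energy_S (a : nat -> R) (sg : R) (N : nat) :
  energy a sg (S N) = energy a sg N + coeff a sg (S N) ^ 2.
Proof. exact (sum_n_m_RS _ N). Qed.

Lemma energy_mono (a : nat -> R) (sg : R) (N M : nat) : (N <= M)%nat ->
  energy a sg N <= energy a sg M.
Proof.
induction 1 as [|M _ IH]; [apply Rle_refl|].
rewrite energy_S; pose proof (pow2_ge_0 (coeff a sg (S M))); lra.
Qed.

(** The inner twist erases the multiples of p. The outer one then places a copy of what is left on
    the numbers p m, with unchanged weight since p^sg p^(-sg) = 1; the supports are disjoint, so the
    energies simply add. *)
Lemma energy_mollify_step_le (a : nat -> R) (sg : R) (p N : nat) : (1 <= p)%nat ->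
  invariant p a -> energy (mollify_step sg a p) sg N <= 2 * energy a sg N.
Proof.
intros Hp Ha.
apply Rle_trans with (energy a sg N + energy a sg (N / p)).
- unfold energy; rewrite <- (sum_dilate p) by easy.
  rewrite <- sum_n_m_Rplus; apply sum_le_loc; intros n Hn.
  unfold coeff at 1, mollify_step, twist at 1.
  destruct (divide_cases p n Hp) as [[m ->]|Hd].
  + assert (Hm : (1 <= m)%nat) by nia.
    rewrite !dilate_mul, Rpower_mult_INR by easy.
    destruct (twist_invariant p (p * m) a Hp ltac:(nia) Ha) as [[_ ->]|[H _]];
      [|destruct H; exists m; lia].
    replace (((0 - Rpower (INR p) sg * twist p 1 a m) *
      (Rpower (INR p) (- sg) * Rpower (INR m) (- sg))) ^ 2)
      with (((Rpower (INR p) sg * Rpower (INR p) (- sg))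
             * (twist p 1 a m * Rpower (INR m) (- sg))) ^ 2) by ring.
    rewrite Rpower_neg_cancel, Rmult_1_l.
    pose proof (pow2_ge_0 (coeff a sg (p * m))).
    assert ((twist p 1 a m * Rpower (INR m) (- sg)) ^ 2 <= coeff a sg m ^ 2); [|lra].
    unfold coeff; destruct (twist_invariant p m a Hp Hm Ha) as [[_ ->]|[_ ->]];
      [|apply Rle_refl].
    rewrite Rmult_0_l, pow_i by lia; apply pow2_ge_0.
  + rewrite !dilate_not by easy.
    destruct (twist_invariant p n a Hp ltac:(lia) Ha) as [[H _]|[_ ->]]; [easy|].
    unfold coeff; right; ring.
- pose proof (energy_mono a sg (N / p) N
    ltac:(apply Nat.Div0.div_le_upper_bound; nia)); lra.
Qed.

(** The factor expands to 1 - (1 + p^sg) p^(-s) + p^sg p^(-2s), whose terms have moduli 1, 1 + x and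
    x on the line. As [a] vanishes on multiples of p, the three shifted copies do not overlap, and 1
    + (1+x)^2 + x^2 = 2 + 2x + 2x^2. The shortest length N/p/p bounds all three energies from
    below. *)
Lemma energy_mollify_step_ge (a : nat -> R) (sg : R) (p N : nat) : (1 <= p)%nat ->
  vanishing p a ->
  let x := Rpower (INR p) (- sg) in
  (2 + 2 * x + 2 * x ^ 2) * energy a sg (N / p / p) <= energy (mollify_step sg a p) sg N.
Proof.
intros Hp Ha x.
apply Rle_trans with (energy a sg N + (1 + x) ^ 2 * energy a sg (N / p)
                      + x ^ 2 * energy a sg (N / p / p)).
- assert (H : (N / p / p <= N / p /\ N / p <= N)%nat).
  { split; apply Nat.Div0.div_le_upper_bound; nia. }
  pose proof (energy_mono a sg _ _ (proj1 H)); pose proof (energy_mono a sg _ _ (proj2 H)).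
  pose proof (pow2_ge_0 (1 + x)); nra.
- unfold energy; rewrite <- !(sum_dilate p) by easy.
  rewrite <- !sum_n_m_Rmult_l, <- !sum_n_m_Rplus; apply sum_le_loc; intros n Hn; right.
  unfold coeff at 4, mollify_step, twist at 1.
  destruct (divide_cases p n Hp) as [[m ->]|Hd].
  + assert (Hm : (1 <= m)%nat) by nia.
    rewrite !dilate_mul, Rpower_mult_INR by easy; fold x.
    unfold twist; rewrite dilate_mul, (Ha m) by easy.
    replace (coeff a sg (p * m)) with 0 by (unfold coeff; rewrite Ha by easy; ring).
    pose proof (Rpower_neg_cancel (INR p) sg) as HP; fold x in HP.
    destruct (divide_cases p m Hp) as [[k ->]|Hd].
    * assert (Hk : (1 <= k)%nat) by nia.
      rewrite !dilate_mul, Rpower_mult_INR by easy; fold x; unfold coeff.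
      rewrite (Ha k) by easy.
      replace ((0 - 1 * 0 - Rpower (INR p) sg * (0 - 1 * a k)) *
        (x * (x * Rpower (INR k) (- sg))))
        with ((Rpower (INR p) sg * x) * x * (a k * Rpower (INR k) (- sg))) by ring.
      rewrite HP; ring.
    * rewrite !(dilate_not p m) by easy; unfold coeff.
      replace ((0 - 1 * a m - Rpower (INR p) sg * (a m - 1 * 0)) *
        (x * Rpower (INR m) (- sg)))
        with (- (x + Rpower (INR p) sg * x) * (a m * Rpower (INR m) (- sg))) by ring.
      rewrite HP; ring.
  + rewrite !dilate_not by easy; unfold twist; rewrite dilate_not by easy.
    unfold coeff; ring.
Qed.

Definition mollify (sg : R) (l : list nat) (a : nat -> R) : nat -> R :=
  fold_left (mollify_step sg) l a.

Definition mollifier (sg : R) (l : list nat) (s : C) : C :=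
  fold_right (fun p w => (w * ((1 - Rpower (INR p) sg * Rcpow (INR p) (- s))
                               * (1 - 1 * Rcpow (INR p) (- s))))%C) (RtoC 1) l.

(** The product of the ratios of 2 + 2x + 2x^2 to 2, that is, of the lower growth factor for [W]
    alone to the upper one for its product with eta. *)
Definition gain (sg : R) (l : list nat) : R :=
  fold_right (fun p w => (1 + Rpower (INR p) (- sg) + Rpower (INR p) (- sg) ^ 2) * w) 1 l.

(** Coprimality is the property of distinct primes through which the Euler factors act
    independently. *)
Definition pairwise_coprime (l : list nat) : Prop :=
  ForallOrdPairs (fun p q => Nat.gcd p q = 1%nat) l.

Lemma approximated_mollify (sg : R) (l : list nat) (f : R -> C) (a : nat -> R) :
  0 < sg -> Forall (le 1) l -> approximated sg f a ->
  approximated sg (fun t => mollifier sg l (sg, t) * f t)%C (mollify sg l a).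
Proof.
intros Hs; revert f a; induction l as [|p l IH]; intros f a Hl H; simpl.
- destruct H as [K [HK H]]; exists K; split; [easy|]; intros eps Heps.
  destruct (H eps Heps) as [N0 HN0]; exists N0; intros N t HN Ht HKt.
  rewrite Cmult_1_l; now apply HN0.
- inversion Hl as [|? ? Hp Hl']; subst.
  apply (approximated_twist sg f a p 1 Hs Hp) in H.
  apply (approximated_twist sg _ _ p (Rpower (INR p) sg) Hs Hp) in H.
  apply (IH _ _ Hl') in H.
  destruct H as [K [HK H]]; exists K; split; [easy|]; intros eps Heps.
  destruct (H eps Heps) as [N0 HN0]; exists N0; intros N t HN Ht HKt.
  rewrite <- !Cmult_assoc; now apply HN0.
Qed.

Lemma bounded_mollify (sg : R) (l : list nat) (a : nat -> R) :
  bounded_coefficients a -> bounded_coefficients (mollify sg l a).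
Proof.
revert a; induction l as [|p l IH]; intros a H; [exact H|].
apply IH, bounded_twist, bounded_twist, H.
Qed.

Lemma energy_mollify_le (sg : R) (l : list nat) (a : nat -> R) (N : nat) :
  Forall (le 1) l -> pairwise_coprime l -> Forall (fun p => invariant p a) l ->
  energy (mollify sg l a) sg N <= 2 ^ length l * energy a sg N.
Proof.
revert a; induction l as [|p l IH]; intros a Hl Hc Ha; simpl; [lra|].
inversion Hl as [|? ? Hp Hl']; inversion Hc as [|? ? Hpc Hc'];
  inversion Ha as [|? ? Hpa Ha']; subst.
pose proof (energy_mollify_step_le a sg p N Hp Hpa) as H.
pose proof (IH (mollify_step sg a p) Hl' Hc') as H2.
eapply Rle_trans; [apply H2|].
- rewrite Forall_forall in *; intros q Hq.
  apply invariant_twist, invariant_twist; auto.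
- assert (0 < 2 ^ length l) by (apply pow_lt; lra); nra.
Qed.

Lemma energy_mollify_ge (sg : R) (l : list nat) (a : nat -> R) (La : R) :
  Forall (le 1) l -> pairwise_coprime l -> Forall (fun p => vanishing p a) l -> 0 <= La ->
  (exists N0, forall N, (N0 <= N)%nat -> La <= energy a sg N) ->
  exists N0, forall N, (N0 <= N)%nat ->
    2 ^ length l * gain sg l * La <= energy (mollify sg l a) sg N.
Proof.
revert a La; induction l as [|p l IH]; intros a La Hl Hc Ha HLa [N0 HN0]; simpl.
- exists N0; intros N HN; rewrite !Rmult_1_l; now apply HN0.
- inversion Hl as [|? ? Hp Hl']; inversion Hc as [|? ? Hpc Hc'];
    inversion Ha as [|? ? Hpa Ha']; subst.
  set (x := Rpower (INR p) (- sg)).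
  assert (Hx : 0 < x) by apply Rpower_pos.
  destruct (IH (mollify_step sg a p) ((2 + 2 * x + 2 * x ^ 2) * La) Hl' Hc') as [N1 HN1].
  + rewrite Forall_forall in *; intros q Hq.
    apply vanishing_twist, vanishing_twist; auto.
  + nra.
  + exists (p * (p * N0))%nat; intros N HN.
    eapply Rle_trans; [|now apply energy_mollify_step_ge]; fold x.
    apply Rmult_le_compat_l; [nra|].
    apply HN0, Nat.div_le_lower_bound; [lia|].
    apply Nat.div_le_lower_bound; [lia|exact HN].
  + exists N1; intros N HN; eapply Rle_trans; [|now apply HN1].
    fold (gain sg l) x; right; ring.
Qed.

(** * Divergence of the Euler product *)

(** Only the factors 1 - p^(-s): on an invariant sequence this is the sieve of Eratosthenes, here
    applied to the constant sequence 1. *)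
Definition sieve (l : list nat) (a : nat -> R) : nat -> R :=
  fold_left (fun a p => twist p 1 a) l a.

Lemma sieve_vanishing (l : list nat) (a : nat -> R) (q : nat) :
  Forall (le 1) l -> pairwise_coprime l -> Forall (fun p => invariant p a) l -> In q l ->
  vanishing q (sieve l a).
Proof.
assert (K : forall l a q, (1 <= q)%nat -> Forall (le 1) l ->
  Forall (fun p => Nat.gcd q p = 1%nat) l -> vanishing q a -> vanishing q (sieve l a)).
{ clear; induction l as [|p l IH]; intros a q Hq Hl Hg H; [exact H|].
  inversion Hl; inversion Hg; subst; apply IH; auto.
  apply vanishing_twist; auto; now rewrite Nat.gcd_comm. }
revert a; induction l as [|p l IH]; intros a Hl Hc Ha Hq; [destruct Hq|].
inversion Hl as [|? ? Hp Hl']; inversion Hc as [|? ? Hpc Hc'];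
  inversion Ha as [|? ? Hpa Ha']; subst.
destruct Hq as [->|Hq].
- apply (K l (twist q 1 a)); auto.
  intros n Hn.
  destruct (twist_invariant q (q * n) a Hp ltac:(nia) Hpa) as [[_ H]|[H _]]; [exact H|].
  destruct H; exists n; lia.
- apply IH; auto.
  rewrite Forall_forall in *; intros r Hr; apply invariant_twist; auto.
Qed.

Lemma sieve_bounds (l : list nat) (a : nat -> R) :
  Forall (le 1) l -> pairwise_coprime l -> Forall (fun p => invariant p a) l ->
  (forall n, (1 <= n)%nat -> 0 <= a n) ->
  forall n, (1 <= n)%nat -> 0 <= sieve l a n <= a n.
Proof.
revert a; induction l as [|p l IH]; intros a Hl Hc Ha H0 n Hn; simpl.
- split; [auto|lra].
- inversion Hl as [|? ? Hp Hl']; inversion Hc as [|? ? Hpc Hc'];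
    inversion Ha as [|? ? Hpa Ha']; subst.
  assert (B : forall m, (1 <= m)%nat -> 0 <= twist p 1 a m <= a m).
  { intros m Hm; pose proof (H0 m Hm).
    destruct (twist_invariant p m a Hp Hm Hpa) as [[_ ->]|[_ ->]]; lra. }
  destruct (IH (twist p 1 a) Hl' Hc') with n as [B1 B2]; auto.
  + rewrite Forall_forall in *; intros q Hq; apply invariant_twist; auto.
  + intros m Hm; apply B, Hm.
  + pose proof (B n Hn); lra.
Qed.

Definition weighted_sum (a : nat -> R) (N : nat) : R := sum_n_m (fun n => a n / INR n) 1 N.

Definition euler_factor (l : list nat) : R := fold_right (fun p w => (1 - / INR p) * w) 1 l.

(** The exact loss is 1/p times the sum up to N/p, and nonnegativity bounds that by the sum up to
    N. *)
Lemma weighted_sum_twist (a : nat -> R) (p N : nat) : (1 <= p)%nat ->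
  (forall n, (1 <= n)%nat -> 0 <= a n) ->
  (1 - / INR p) * weighted_sum a N <= weighted_sum (twist p 1 a) N.
Proof.
intros Hp Ha.
assert (HP : 1 <= INR p) by now apply INR_ge_one.
assert (HP' : 0 < / INR p) by (apply Rinv_0_lt_compat; lra).
assert (E : weighted_sum (twist p 1 a) N
  = weighted_sum a N - / INR p * weighted_sum a (N / p)).
{ unfold weighted_sum; rewrite <- (sum_dilate p), <- sum_n_m_Rmult_l by easy.
  set (D := sum_n_m (fun k => / INR p * dilate p (fun n => a n / INR n) k) 1 N).
  assert (E : sum_n_m (fun n => twist p 1 a n / INR n) 1 N + D
    = sum_n_m (fun n => a n / INR n) 1 N); [|lra].
  unfold D; rewrite <- sum_n_m_Rplus.
  apply sum_n_m_ext_loc; intros n Hn; unfold twist.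
  destruct (divide_cases p n Hp) as [[m ->]|Hd].
  - assert (Hm : 1 <= INR m) by (apply INR_ge_one; nia).
    rewrite !dilate_mul, mult_INR by easy.
    match goal with |- ?x = ?y => change (@eq R x y) end; field; lra.
  - rewrite !dilate_not by easy.
    match goal with |- ?x = ?y => change (@eq R x y) end; field.
    split; [apply not_0_INR; lia|lra]. }
assert (M : weighted_sum a (N / p) <= weighted_sum a N).
{ assert (HN : (N / p <= N)%nat) by (apply Nat.Div0.div_le_upper_bound; nia).
  revert HN; generalize (N / p)%nat; clear E; intros k HN.
  induction HN as [|M _ IH]; [apply Rle_refl|].
  unfold weighted_sum at 2; rewrite sum_n_m_RS; fold (weighted_sum a M).
  assert (0 <= a (S M) / INR (S M)); [|lra].
  apply Rmult_le_pos; [apply Ha; lia|apply Rlt_le, Rinv_0_lt_compat, INR_S_pos]. }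
rewrite E; nra.
Qed.

Lemma euler_factor_pos (l : list nat) : Forall (le 2) l -> 0 < euler_factor l.
Proof.
induction 1 as [|p l Hp _ IH]; simpl; [lra|].
apply Rmult_lt_0_compat; [|exact IH].
assert (2 <= INR p) by (apply (le_INR 2), Hp).
assert (/ INR p <= / 2) by (apply Rinv_le_contravar; lra); lra.
Qed.

Lemma Forall_le_trans (m n : nat) (l : list nat) : (m <= n)%nat ->
  Forall (le n) l -> Forall (le m) l.
Proof. intros Hmn; apply Forall_impl; intros; lia. Qed.

Lemma weighted_sum_sieve (l : list nat) (a : nat -> R) (N : nat) :
  Forall (le 2) l -> pairwise_coprime l -> Forall (fun p => invariant p a) l ->
  (forall n, (1 <= n)%nat -> 0 <= a n) ->
  euler_factor l * weighted_sum a N <= weighted_sum (sieve l a) N.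
Proof.
revert a; induction l as [|p l IH]; intros a Hl Hc Ha H0; simpl; [lra|].
pose proof (sieve_bounds (p :: nil) a) as B.
inversion Hl as [|? ? Hp Hl']; inversion Hc as [|? ? Hpc Hc'];
  inversion Ha as [|? ? Hpa Ha']; subst.
pose proof (euler_factor_pos l Hl') as He.
eapply Rle_trans; [|apply IH; auto].
- pose proof (weighted_sum_twist a p N ltac:(lia) H0).
  replace ((1 - / INR p) * euler_factor l * weighted_sum a N)
    with (euler_factor l * ((1 - / INR p) * weighted_sum a N)) by ring.
  apply Rmult_le_compat_l; lra.
- pose proof (Forall_le_trans 1 2 l ltac:(lia) Hl').
  rewrite Forall_forall in *; intros q Hq; apply invariant_twist; auto; lia.
- intros n Hn; apply B; auto.
  + constructor; [lia|constructor].
  + constructor; constructor.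
Qed.

Lemma harmonic_ge_ln (N : nat) : ln (INR (S N)) <= weighted_sum (fun _ => 1) N.
Proof.
induction N as [|N IH].
- unfold weighted_sum; rewrite sum_n_m_zero by lia; simpl; rewrite ln_1; apply Rle_refl.
- unfold weighted_sum; rewrite sum_n_m_RS; fold (weighted_sum (fun _ => 1) N).
  pose proof (INR_S_pos N) as H.
  replace (INR (S (S N))) with (INR (S N) * (1 + / INR (S N)))
    by (rewrite (S_INR (S N)); field; lra).
  assert (0 < / INR (S N)) by now apply Rinv_0_lt_compat.
  rewrite ln_mult by lra.
  pose proof (ln_le_minus_one (1 + / INR (S N)) ltac:(lra)); lra.
Qed.

(* The sieve of Eratosthenes; 2 is set apart because the alternating signs are only
   invariant under dilation by odd numbers. *)
Lemma exists_sieving_list (N : nat) : (2 <= N)%nat ->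
  exists l, Forall (fun p => (2 <= p <= N)%nat) l /\ pairwise_coprime (2%nat :: l) /\
    forall n, (2 <= n <= N)%nat -> exists p, In p (2%nat :: l) /\ Nat.divide p n.
Proof.
induction 1 as [|N HN [l [Hl [Hc Hd]]]].
- exists nil; repeat split.
  + constructor.
  + repeat constructor.
  + intros n Hn; exists 2%nat; split; [now left|]; exists 1%nat; lia.
- destruct (Exists_dec (fun p => Nat.divide p (S N)) (2%nat :: l)) as [H|H].
  { intros p; destruct (Nat.eq_dec (S N mod p) 0) as [E|E].
    - left; now apply Nat.Lcm0.mod_divide.
    - right; intros D; apply E; now apply Nat.Lcm0.mod_divide. }
  + apply Exists_exists in H; destruct H as [q [Hq Hqd]].
    exists l; repeat split; [|exact Hc|].
    * revert Hl; apply Forall_impl; intros; lia.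
    * intros n Hn; destruct (Nat.eq_dec n (S N)) as [->|]; [now exists q|].
      apply Hd; lia.
  (* Here no listed number divides S N. A common divisor g > 1 with a listed q would be at most N,
     hence have a listed divisor, which would then divide S N. *)
  + assert (Hg : forall q, In q (2%nat :: l) -> Nat.gcd (S N) q = 1%nat).
    { intros q Hq.
      assert (Hq2 : (2 <= q <= N)%nat).
      { destruct Hq as [<-|Hq]; [lia|]; rewrite Forall_forall in Hl; now apply Hl. }
      pose proof (Nat.gcd_divide_l (S N) q) as G1; pose proof (Nat.gcd_divide_r (S N) q) as G2.
      set (g := Nat.gcd (S N) q) in *.
      pose proof (Nat.divide_pos_le g q ltac:(lia) G2).
      destruct (Nat.eq_dec g 1) as [E|E]; [exact E|exfalso].
      assert (g <> 0)%nat by (intros E0; rewrite E0 in G2; destruct G2; lia).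
      destruct (Hd g ltac:(lia)) as [r [Hr Hrg]].
      apply H, Exists_exists; exists r; split; [exact Hr|].
      now apply Nat.divide_trans with g. }
    exists (S N :: l); repeat split.
    * constructor; [lia|]; revert Hl; apply Forall_impl; intros; lia.
    * inversion Hc as [|? ? Hc2 Hc']; subst; constructor; [|constructor; [|exact Hc']].
      -- constructor; [rewrite Nat.gcd_comm; apply Hg; now left|exact Hc2].
      -- apply Forall_forall; intros q Hq; apply Hg; now right.
    * intros n Hn; destruct (Nat.eq_dec n (S N)) as [->|].
      -- exists (S N); split; [right; now left|apply Nat.divide_refl].
      -- destruct (Hd n ltac:(lia)) as [p [Hp Hpn]]; exists p; split; [|exact Hpn].
         destruct Hp as [Hp|Hp]; [now left|right; now right].
Qed.

Lemma gain_pos (sg : R) (l : list nat) : 0 < gain sg l.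
Proof.
induction l as [|p l IH]; simpl; [lra|].
pose proof (Rpower_pos (INR p) (- sg)); apply Rmult_lt_0_compat; nra.
Qed.

(** With y = 1/p <= x, a single gain just fails, as (1 + y + y^2)(1 - y) = 1 - y^3. The square
    provides the margin: (1 - y^3)(1 + y + y^2) >= 1 for y <= 1/2. *)
Lemma gain_sqr_euler_factor (sg : R) (l : list nat) : sg <= 1 -> Forall (le 2) l ->
  1 <= gain sg l ^ 2 * euler_factor l.
Proof.
intros Hs; induction 1 as [|p l Hp Hl IH]; [simpl; lra|].
change (1 <= ((1 + Rpower (INR p) (- sg) + Rpower (INR p) (- sg) ^ 2) * gain sg l) ^ 2
  * ((1 - / INR p) * euler_factor l)).
assert (HP : 2 <= INR p) by (apply (le_INR 2), Hp).
set (y := / INR p); set (x := Rpower (INR p) (- sg)).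
assert (Hy : 0 < y <= / 2).
{ split; [apply Rinv_0_lt_compat; lra|apply Rinv_le_contravar; lra]. }
assert (Hxy : y <= x).
{ unfold x, y; rewrite <- (Rpower_1 (INR p)) at 1 by lra.
  rewrite <- Rpower_Ropp; apply Rle_Rpower; lra. }
assert (F : 1 <= (1 + x + x ^ 2) ^ 2 * (1 - y)).
{ apply Rle_trans with ((1 + y + y ^ 2) ^ 2 * (1 - y)).
  - replace ((1 + y + y ^ 2) ^ 2 * (1 - y)) with ((1 - y ^ 3) * (1 + y + y ^ 2)) by ring.
    assert (y ^ 2 <= y / 2) by nra.
    assert (y ^ 3 <= y / 4) by nra.
    nra.
  - apply Rmult_le_compat_r; [lra|]; apply pow_incr; nra. }
replace (((1 + x + x ^ 2) * gain sg l) ^ 2 * ((1 - y) * euler_factor l))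
  with (((1 + x + x ^ 2) ^ 2 * (1 - y)) * (gain sg l ^ 2 * euler_factor l)) by ring.
apply Rle_trans with (1 * 1); [lra|apply Rmult_le_compat; lra].
Qed.

(** Euler's argument: sieving the constant sequence 1 leaves only n = 1 up to N, so the Euler
    product times the harmonic sum is at most 1. The product is thus small, and the squared gain
    dominates its inverse. *)
Lemma gain_unbounded (sg M : R) : sg <= 1 ->
  exists l, Forall (fun p => (2 <= p)%nat /\ Nat.Odd p) l /\ pairwise_coprime l /\ M <= gain sg l.
Proof.
intros Hs.
(* The gain enters squared, and the Euler factor 1/2 of the number 2, which is kept out of [l],
   accounts for the 2 in the exponent. *)
destruct (nfloor_ex (exp (2 * M ^ 2)) ltac:(apply Rlt_le, exp_pos)) as [k [_ Hk]].
set (N := S (S k)).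
destruct (exists_sieving_list N ltac:(unfold N; lia)) as [l [Hl [Hc Hd]]].
assert (Hl2 : Forall (le 2) l) by (revert Hl; apply Forall_impl; intros; lia).
assert (Hl2' : Forall (le 2) (2%nat :: l)) by (constructor; [lia|exact Hl2]).
inversion Hc as [|? ? Hc2 Hc']; subst.
exists l; repeat split; [|exact Hc'|].
- rewrite Forall_forall in *; intros p Hp; split; [now apply Hl2|].
  destruct (Nat.Even_or_Odd p) as [[q ->]|Ho]; [|exact Ho].
  specialize (Hc2 _ Hp).
  assert (D : Nat.divide 2 (Nat.gcd 2 (2 * q))).
  { apply Nat.gcd_greatest; [apply Nat.divide_refl|exists q; lia]. }
  rewrite Hc2 in D; apply Nat.divide_pos_le in D; lia.
- assert (I1 : Forall (fun p => invariant p (fun _ => 1)) (2%nat :: l)).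
  { apply Forall_forall; intros p _ n _; reflexivity. }
  assert (P1 : forall n, (1 <= n)%nat -> 0 <= 1) by (intros; lra).
  assert (L1 : Forall (le 1) (2%nat :: l)) by (apply (Forall_le_trans 1 2); [lia|easy]).
  pose proof (weighted_sum_sieve (2%nat :: l) (fun _ => 1) N Hl2' Hc I1 P1) as H.
  assert (U : weighted_sum (sieve (2%nat :: l) (fun _ => 1)) N <= 1).
  { pose proof (sieve_bounds _ _ L1 Hc I1 P1) as B.
    assert (V : forall n, (2 <= n <= N)%nat -> sieve (2%nat :: l) (fun _ => 1) n = 0).
    { intros n Hn; destruct (Hd n Hn) as [p [Hp [q ->]]].
      rewrite Nat.mul_comm; apply (sieve_vanishing _ _ p L1 Hc I1 Hp); nia. }
    unfold weighted_sum; rewrite sum_Sn_m by (unfold N; lia).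
    rewrite (sum_n_m_ext_loc _ (fun _ => zero)), sum_n_m_const_zero, plus_zero_r.
    - specialize (B 1%nat (le_n _)); change (INR 1) with 1; lra.
    - intros n Hn; rewrite V by lia; unfold Rdiv; apply Rmult_0_l. }
  simpl euler_factor in H; fold (euler_factor l) in H.
  pose proof (harmonic_ge_ln N) as HH.
  assert (HL : 2 * M ^ 2 <= ln (INR (S N))).
  { rewrite <- (ln_exp (2 * M ^ 2)); apply ln_le; [apply exp_pos|].
    unfold N; rewrite !S_INR; lra. }
  pose proof (gain_sqr_euler_factor sg l Hs Hl2) as HG.
  pose proof (euler_factor_pos l Hl2) as He.
  pose proof (gain_pos sg l) as Hg.
  assert (HE : euler_factor l * M ^ 2 <= 1).
  { replace (1 - / (1 + 1)) with (/ 2) in H by field.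
    assert (euler_factor l * (2 * M ^ 2) <= euler_factor l * weighted_sum (fun _ => 1) N)
      by (apply Rmult_le_compat_l; lra).
    lra. }
  destruct (Rle_lt_dec M (gain sg l)) as [|Hlt]; [easy|exfalso].
  assert (gain sg l ^ 2 < M ^ 2) by nra.
  nra.
Qed.

(** * The values of |zeta| *)

Lemma invariant_altsign (p : nat) : Nat.Odd p -> invariant p altsign.
Proof.
intros [q ->] n _; unfold altsign.
replace (S ((2 * q + 1) * n)) with (2 * (q * n) + S n)%nat by lia.
rewrite pow_add, pow_1_even; apply Rmult_1_l.
Qed.

Lemma energy_altsign_le (sg : R) (N : nat) : 1 / 2 < sg ->
  energy altsign sg N <= 1 + / (2 * sg - 1).
Proof.
intros Hs; set (a := 2 * sg - 1).
assert (Ha : 0 < a) by (unfold a; lra).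
assert (E : forall n, coeff altsign sg n ^ 2 = Rpower (INR n) (- a - 1)).
{ intros n; unfold coeff.
  replace ((altsign n * Rpower (INR n) (- sg)) ^ 2)
    with (altsign n * altsign n * (Rpower (INR n) (- sg) * Rpower (INR n) (- sg))) by ring.
  rewrite altsign_sqr, <- Rpower_plus, Rmult_1_l; f_equal; unfold a; ring. }
destruct N as [|N].
{ unfold energy; rewrite sum_n_m_zero by lia; change zero with 0.
  assert (0 < / a) by now apply Rinv_0_lt_compat.
  lra. }
(* The tail of the comparison integral is kept so that the induction closes. *)
apply Rle_trans with (1 + / a - Rpower (INR (S N)) (- a) / a).
- induction N as [|N IH].
  + rewrite energy_S, E; unfold energy; rewrite sum_n_m_zero by lia.
    change zero with 0; change (INR 1) with 1; rewrite !Rpower_1_l.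
    unfold Rdiv; rewrite Rmult_1_l; lra.
  + rewrite energy_S, E.
    pose proof (Rpower_neg_step a (S N) Ha ltac:(lia)) as H.
    assert (Rpower (INR (S (S N))) (- a - 1)
      <= (Rpower (INR (S N)) (- a) - Rpower (INR (S (S N))) (- a)) / a).
    { apply Rmult_le_reg_l with a; [easy|].
      unfold Rdiv; rewrite (Rmult_comm a (_ * / a)), Rmult_assoc, Rinv_l; lra. }
    unfold Rdiv in *; lra.
- assert (0 < Rpower (INR (S N)) (- a) / a) by (apply Rdiv_lt_0_compat; [apply Rpower_pos|easy]).
  lra.
Qed.

Lemma approximated_eta (sg : R) : 0 < sg < 1 -> approximated sg (fun t => eta (sg, t)) altsign.
Proof.
intros Hs; exists 1; split; [lra|]; intros eps Heps.
assert (Hl : is_lim_seq (fun N => (2 + 4 / sg) * Rpower (INR N) (- sg)) 0).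
{ replace (Finite 0) with (Rbar_mult (2 + 4 / sg) 0) by (simpl; now rewrite Rmult_0_r).
  apply is_lim_seq_scal_l, Rpower_lim_0; lra. }
apply is_lim_seq_spec in Hl.
destruct (Hl (mkposreal eps Heps)) as [N0 HN0]; simpl in HN0.
exists (S N0); intros N t HN Ht HKt.
eapply Rle_trans; [apply eta_error; [easy|lra|lia]|].
specialize (HN0 N ltac:(lia)); rewrite Rminus_0_r in HN0.
apply Rabs_lt_between in HN0; lra.
Qed.

(** The coefficients of the constant function 1, so that mollifying them yields the coefficients of
    the mollifier itself. *)
Definition delta1 (n : nat) : R := if Nat.eqb n 1 then 1 else 0.

Lemma dirichlet_delta1 (s : C) (N : nat) : (1 <= N)%nat -> dirichlet delta1 s N = 1.
Proof.
induction 1 as [|N HN IH]; rewrite dirichlet_S.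
- unfold dirichlet; rewrite sum_n_m_zero by lia; change zero with (RtoC 0).
  change (INR 1) with 1; rewrite Rcpow_1_l; unfold delta1; simpl; ring.
- rewrite IH; unfold delta1; destruct (Nat.eqb_spec (S N) 1); [lia|]; ring.
Qed.

Lemma energy_delta1_ge (sg : R) (N : nat) : (1 <= N)%nat -> 1 <= energy delta1 sg N.
Proof.
intros HN; eapply Rle_trans; [|apply (energy_mono delta1 sg 1 N HN)].
rewrite energy_S; unfold energy; rewrite sum_n_m_zero by lia; change zero with 0.
unfold coeff, delta1; change (INR 1) with 1; rewrite Rpower_1_l; simpl; lra.
Qed.

(* Otherwise eta would be bounded below on the line, and multiplying by the mollifier
   would contradict the mean squares as the gain is unbounded. *)
Lemma zeta_small (sg m : R) : 1 / 2 < sg < 1 -> 0 < m ->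
  exists t, 1 <= t /\ Cmod (zeta (sg, t)) < m.
Proof.
intros Hs Hm; apply NNPP; intros Hno.
assert (Hz : forall t, 1 <= t -> m <= Cmod (zeta (sg, t))).
{ intros t Ht; apply Rnot_lt_le; intros H; apply Hno; now exists t. }
(* On the line |1 - 2^(1-s)| >= 2^(1-sg) - 1, which is positive because sg < 1. *)
set (k := 2 * Rpower 2 (- sg) - 1).
assert (Hk : 0 < k).
{ unfold k; rewrite <- (Rpower_1 2) at 1 by lra; rewrite <- Rpower_plus.
  assert (Rpower 2 0 < Rpower 2 (1 + - sg)) by (apply Rpower_lt; lra).
  rewrite Rpower_O in H; lra. }
assert (He : forall t, 1 <= t -> m * k <= Cmod (eta (sg, t))).
{ intros t Ht; unfold eta; rewrite Cmod_mult, Rmult_comm.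
  apply Rmult_le_compat; [lra|lra| |now apply Hz].
  pose proof (Cmod_triangle (1 - 2 * Rcpow 2 (- (sg, t))) (- (1)))%C as H.
  replace (1 - 2 * Rcpow 2 (- (sg, t)) + - (1))%C
    with (- (2 * Rcpow 2 (- (sg, t))))%C in H by ring.
  rewrite !Cmod_opp, Cmod_mult, Cmod_Rcpow, !Cmod_R, (Rabs_pos_eq 2), Rabs_R1 in H by lra.
  change (Re (- (sg, t))%C) with (- sg) in H; unfold k; lra. }
set (Z := 1 + / (2 * sg - 1)).
(* This choice makes (m k)^2 times the gain exceed 2 Z, where [Z] bounds the energy of the
   alternating signs. The list is fixed before any length N is chosen. *)
destruct (gain_unbounded sg (2 * Z / (m * k) ^ 2 + 1) ltac:(lra)) as [l [Hl [Hc HG]]].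
assert (Hl1 : Forall (le 1) l) by (revert Hl; apply Forall_impl; intros; lia).
destruct (approximated_mollify sg l _ _ ltac:(lra) Hl1 (approximated_eta sg ltac:(lra)))
  as [Kb [HKb Hb]].
assert (Hd1 : approximated sg (fun _ => 1) delta1).
{ exists 1; split; [lra|]; intros eps Heps; exists 1%nat; intros N t HN _ _.
  rewrite dirichlet_delta1 by easy; replace (1 - 1)%C with (RtoC 0) by ring.
  rewrite Cmod_0; lra. }
destruct (approximated_mollify sg l _ _ ltac:(lra) Hl1 Hd1) as [Ka [HKa Ha]].
assert (Bd : bounded_coefficients delta1).
{ exists 1; intros n; unfold delta1; destruct Nat.eqb; rewrite ?Rabs_R1, ?Rabs_R0; lra. }
assert (Ba : bounded_coefficients altsign).
{ exists 1; intros n; rewrite <- Cmod_R, Cmod_altsign; lra. }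
apply (bounded_mollify sg l) in Bd; apply (bounded_mollify sg l) in Ba.
destruct Bd as [ca Hca]; destruct Ba as [cb Hcb].
destruct (energy_mollify_ge sg l delta1 1 Hl1 Hc) as [N1 HN1].
{ revert Hl; apply Forall_impl; intros p [Hp _] n Hn.
  unfold delta1; destruct (Nat.eqb_spec (p * n) 1); [nia|easy]. }
{ lra. }
{ exists 1%nat; intros N HN; now apply energy_delta1_ge. }
assert (Hmk : 0 < m * k) by now apply Rmult_lt_0_compat.
assert (H2 : 0 < 2 ^ length l) by (apply pow_lt; lra).
assert (HZ : 0 < Z).
{ assert (0 < / (2 * sg - 1)) by (apply Rinv_0_lt_compat; lra); unfold Z; lra. }
assert (Hmain : (m * k) ^ 2 * (2 ^ length l * gain sg l * 1) <= 2 * (2 ^ length l * Z)).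
{ apply (energy_le_of_Cmod_le (mollify sg l delta1) (mollify sg l altsign) sg
    (Rmax ca cb) (m * k) (Rmax Ka Kb)); [easy|lra| | | | | |].
  - eapply Rle_trans; [exact HKa|apply Rmax_l].
  - intros n; eapply Rle_trans; [apply Hca|apply Rmax_l].
  - intros n; eapply Rle_trans; [apply Hcb|apply Rmax_r].
  - intros eps Heps.
    destruct (Ha (eps / (2 * (m * k)))) as [Na HNa]; [apply Rdiv_lt_0_compat; lra|].
    destruct (Hb (eps / 2)) as [Nb HNb]; [lra|].
    exists (max Na Nb); intros N t HN Ht HKt.
    pose proof (Rmax_l Ka Kb); pose proof (Rmax_r Ka Kb).
    specialize (HNa N t ltac:(lia) Ht ltac:(nra)).
    specialize (HNb N t ltac:(lia) Ht ltac:(nra)).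
    specialize (He t Ht).
    set (W := mollifier sg l (sg, t)) in *.
    set (A := dirichlet (mollify sg l delta1) (sg, t) N) in *.
    set (B := dirichlet (mollify sg l altsign) (sg, t) N) in *.
    assert (I1 : Cmod A <= Cmod W + eps / (2 * (m * k))).
    { replace A with (W + - (W * 1 - A))%C by ring.
      eapply Rle_trans; [apply Cmod_triangle|]; rewrite Cmod_opp; lra. }
    assert (I2 : Cmod W * Cmod (eta (sg, t)) <= Cmod B + eps / 2).
    { rewrite <- Cmod_mult.
      replace (W * eta (sg, t))%C with (B + (W * eta (sg, t) - B))%C by ring.
      eapply Rle_trans; [apply Cmod_triangle|]; lra. }
    assert (I3 : Cmod W * (m * k) <= Cmod W * Cmod (eta (sg, t)))
      by (apply Rmult_le_compat_l; [apply Cmod_ge_0|exact He]).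
    apply (Rmult_le_compat_l (m * k)) in I1; [|lra].
    replace (m * k * (Cmod W + eps / (2 * (m * k)))) with (Cmod W * (m * k) + eps / 2) in I1
      by (field; split; nra).
    lra.
  - exists N1; exact HN1.
  - intros N; eapply Rle_trans; [apply energy_mollify_le; [easy|easy|]|].
    + revert Hl; apply Forall_impl; intros p [_ Hp]; now apply invariant_altsign.
    + apply Rmult_le_compat_l; [lra|apply energy_altsign_le; lra]. }
assert (Hmain2 : (m * k) ^ 2 * gain sg l <= 2 * Z).
{ apply Rmult_le_reg_l with (2 ^ length l); [easy|]; lra. }
assert (Hsq : 0 < (m * k) ^ 2) by now apply pow_lt.
apply (Rmult_le_compat_l ((m * k) ^ 2)) in HG; [|lra].
replace ((m * k) ^ 2 * (2 * Z / (m * k) ^ 2 + 1)) with (2 * Z + (m * k) ^ 2) in HG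
  by (field; split; lra).
lra.
Qed.

(** * Continuity of the modulus along vertical lines and its intermediate values *)

Definition continuous_Re_Im (f : R -> C) (t : R) : Prop :=
  continuous (fun t => Re (f t)) t /\ continuous (fun t => Im (f t)) t.

Lemma continuous_Re_Im_plus (f g : R -> C) (t : R) :
  continuous_Re_Im f t -> continuous_Re_Im g t -> continuous_Re_Im (fun t => f t + g t)%C t.
Proof.
intros [Hf Hf'] [Hg Hg']; split.
- exact (continuous_plus _ _ _ Hf Hg).
- exact (continuous_plus _ _ _ Hf' Hg').
Qed.

Lemma continuous_Re_Im_minus (f g : R -> C) (t : R) :
  continuous_Re_Im f t -> continuous_Re_Im g t -> continuous_Re_Im (fun t => f t - g t)%C t.
Proof.
intros [Hf Hf'] [Hg Hg']; split.
- exact (continuous_minus _ _ _ Hf Hg).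
- exact (continuous_minus _ _ _ Hf' Hg').
Qed.

Lemma continuous_Re_Im_mult (f g : R -> C) (t : R) :
  continuous_Re_Im f t -> continuous_Re_Im g t -> continuous_Re_Im (fun t => f t * g t)%C t.
Proof.
intros [Hf Hf'] [Hg Hg']; split.
- exact (continuous_minus _ _ _ (continuous_mult _ _ _ Hf Hg) (continuous_mult _ _ _ Hf' Hg')).
- exact (continuous_plus _ _ _ (continuous_mult _ _ _ Hf Hg') (continuous_mult _ _ _ Hf' Hg)).
Qed.

Lemma continuous_Cmod_comp (f : R -> C) (t : R) :
  continuous_Re_Im f t -> continuous (fun t => Cmod (f t)) t.
Proof.
intros [HR HI]; unfold Cmod.
apply (continuous_comp (fun t => fst (f t) ^ 2 + snd (f t) ^ 2) sqrt).
- apply (continuous_plus (fun t => fst (f t) ^ 2) (fun t => snd (f t) ^ 2)).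
  + apply (continuous_comp (fun t => fst (f t)) (fun x => x ^ 2)); [exact HR|].
    apply (ex_derive_continuous (fun x => x ^ 2)); auto_derive; easy.
  + apply (continuous_comp (fun t => snd (f t)) (fun x => x ^ 2)); [exact HI|].
    apply (ex_derive_continuous (fun x => x ^ 2)); auto_derive; easy.
- apply continuity_pt_filterlim, continuity_pt_sqrt; nra.
Qed.

Lemma continuous_Re_Im_Rcpow (x sg t : R) :
  continuous_Re_Im (fun t => Rcpow x (sg, - t)) t.
Proof.
unfold Rcpow; simpl; split.
- apply (ex_derive_continuous (fun t => Rpower x sg * cos (- t * ln x))).
  auto_derive; easy.
- apply (ex_derive_continuous (fun t => Rpower x sg * sin (- t * ln x))).
  auto_derive; easy.
Qed.

Lemma continuous_Cmod_zeta_approx (sg t : R) (N : nat) : sg < 1 ->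
  continuous (fun t => Cmod (zeta_approx (sg, t) N)) t.
Proof.
intros Hs; apply continuous_Cmod_comp; unfold zeta_approx.
apply (continuous_Re_Im_minus
  (fun t => sum_n_m (fun n : nat => Rcpow (INR n) (- (sg, t))%C) 1 N)).
- induction N as [|N IH].
  + split; apply continuous_ext with (fun _ => 0); try apply continuous_const;
      intros u; rewrite sum_n_m_zero by lia; reflexivity.
  + assert (H := continuous_Re_Im_plus _ _ t IH
      (continuous_Re_Im_Rcpow (INR (S N)) (- sg) t)).
    destruct H as [H1 H2]; split.
    * refine (continuous_ext _ _ _ _ H1); intros u; now rewrite sum_n_Sm by lia.
    * refine (continuous_ext _ _ _ _ H2); intros u; now rewrite sum_n_Sm by lia.
- apply (continuous_Re_Im_mult (fun t => Rcpow (INR N) (1 - (sg, t))%C)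
    (fun t => / (1 - (sg, t)))%C).
  + assert (E : forall u, (1 - (sg, u))%C = (1 - sg, - u))
      by (intros u; apply injective_projections; simpl; ring).
    pose proof (continuous_Re_Im_Rcpow (INR N) (1 - sg) t) as [H1 H2]; split.
    * refine (continuous_ext _ _ _ _ H1); intros u; now rewrite E.
    * refine (continuous_ext _ _ _ _ H2); intros u; now rewrite E.
  + assert (Hd : forall u, (1 - sg) * (1 - sg) + u * u <> 0) by (intros u; nra).
    split.
    * apply continuous_ext with (fun u => (1 - sg) / ((1 - sg) * (1 - sg) + u * u)).
      -- intros u; unfold Cinv, Re; simpl; unfold Rdiv; f_equal; try ring; f_equal; ring.
      -- apply (ex_derive_continuous (fun u => (1 - sg) / ((1 - sg) * (1 - sg) + u * u))).
         auto_derive; apply Hd.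
    * apply continuous_ext with (fun u => u / ((1 - sg) * (1 - sg) + u * u)).
      -- assert (E : forall u : R, u / ((1 - sg) * (1 - sg) + u * u)
           = Im (/ (1 - (sg, u)))%C); [|exact E].
         intros u; unfold Cinv, Im; simpl; unfold Rdiv; f_equal; try ring; f_equal; ring.
      -- apply (ex_derive_continuous (fun u => u / ((1 - sg) * (1 - sg) + u * u))).
         auto_derive; apply Hd.
Qed.

Lemma Cmod_diff_le (z w : C) : Rabs (Cmod z - Cmod w) <= Cmod (z - w)%C.
Proof.
apply Rabs_le; split.
- pose proof (Cmod_triangle z (- (z - w))%C) as H; rewrite Cmod_opp in H.
  replace (z + - (z - w))%C with w in H by ring; lra.
- pose proof (Cmod_triangle w (z - w)%C) as H.
  replace (w + (z - w))%C with z in H by ring; lra.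
Qed.

(** A locally uniform limit of continuous functions: for |u - t| < 1 the factor |s| in the error is
    at most sg + |t| + 1, so one N serves the whole neighbourhood. *)
Lemma continuous_Cmod_zeta (sg t : R) : 0 < sg < 1 ->
  continuous (fun t => Cmod (zeta (sg, t))) t.
Proof.
intros Hs; apply filterlim_locally; intros eps.
set (D := 32 * (sg + Rabs t + 1) / sg).
assert (Hl : is_lim_seq (fun N => D * Rpower (INR N) (- sg)) 0).
{ replace (Finite 0) with (Rbar_mult D 0) by (simpl; now rewrite Rmult_0_r).
  apply is_lim_seq_scal_l, Rpower_lim_0; lra. }
apply is_lim_seq_spec in Hl.
assert (He3 : 0 < eps / 3) by (destruct eps; simpl; lra).
destruct (Hl (mkposreal _ He3)) as [N0 HN0]; simpl in HN0.
specialize (HN0 (S N0) ltac:(lia)); rewrite Rminus_0_r in HN0.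
apply Rabs_lt_between in HN0.
assert (B : forall u, Rabs (u - t) < 1 ->
  Rabs (Cmod (zeta (sg, u)) - Cmod (zeta_approx (sg, u) (S N0))) < eps / 3).
{ intros u Hu; eapply Rle_lt_trans; [apply Cmod_diff_le|].
  eapply Rle_lt_trans; [apply zeta_approx_error; [easy|lia]|].
  eapply Rle_lt_trans; [|apply HN0].
  apply Rmult_le_compat_r; [apply Rlt_le, Rpower_pos|].
  apply Rmult_le_compat_r; [apply Rlt_le, Rinv_0_lt_compat; simpl; lra|].
  apply Rmult_le_compat_l; [lra|].
  eapply Rle_trans; [apply Cmod_le_Re_Im|]; simpl; rewrite (Rabs_pos_eq sg) by lra.
  pose proof (Rabs_triang (u - t) t); replace (u - t + t) with u in H by ring; lra. }
pose proof (continuous_Cmod_zeta_approx sg t (S N0) ltac:(lra)) as Hc.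
pose proof (proj1 (filterlim_locally _ _) Hc (mkposreal _ He3)) as Hc3.
assert (H1 : locally t (fun u => Rabs (u - t) < 1)).
{ exists (mkposreal 1 Rlt_0_1); intros u Hu; exact Hu. }
assert (K : forall u : R,
  Rabs (Cmod (zeta_approx (sg, u) (S N0)) - Cmod (zeta_approx (sg, t) (S N0))) < eps / 3 ->
  Rabs (u - t) < 1 -> Rabs (Cmod (zeta (sg, u)) - Cmod (zeta (sg, t))) < eps).
{ intros u Hu1 Hu2.
  pose proof (B u Hu2) as B1.
  pose proof (B t ltac:(rewrite Rminus_diag, Rabs_R0; lra)) as B2.
  apply Rabs_lt_between in Hu1; apply Rabs_lt_between in B1; apply Rabs_lt_between in B2.
  apply Rabs_lt_between; lra. }
generalize (filter_and _ _ Hc3 H1); apply filter_imp; intros u [Hu1 Hu2].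
exact (K u Hu1 Hu2).
Qed.

Lemma zeta_modulus_value (a b v : R) : 1 / 2 < a -> a < b -> b < 1 -> 0 < v <= 1 ->
  exists w : C, a < Re w < b /\ 0 < Im w /\ Cmod (zeta w) = v.
Proof.
intros Ha Hab Hb Hv.
set (sg := (a + b) / 2).
assert (Hs : 1 / 2 < sg < 1) by (unfold sg; lra).
set (g := fun t => Cmod (zeta (sg, t))).
assert (Hg : forall t, continuous g t) by (intros t; apply continuous_Cmod_zeta; lra).
assert (H0 : 1 < g 0).
{ unfold g; pose proof (Re_zeta_real_lt sg Hs) as H.
  pose proof (proj1 (Re_Im_le (zeta (sg, 0)))) as H2.
  rewrite Rabs_left in H2 by lra; lra. }
(* The point w must lie strictly above the real axis, so the intermediate value theorem starts at a
   small positive t1, where the modulus still exceeds 1. *)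
assert (H1 : exists t1, 0 < t1 < 1 /\ 1 < g t1).
{ pose proof (Hg 0) as Hc.
  destruct (proj1 (filterlim_locally _ _) Hc (mkposreal (g 0 - 1) ltac:(lra))) as [d Hd]; simpl in Hd.
  pose proof (cond_pos d) as Hdp.
  set (t1 := Rmin (d / 2) (1 / 2)).
  assert (Ht1 : 0 < t1 /\ t1 <= d / 2 /\ t1 <= 1 / 2).
  { unfold t1; split; [apply Rmin_glb_lt; lra|split; [apply Rmin_l|apply Rmin_r]]. }
  exists t1; split; [lra|].
  assert (Hb1 : ball 0 d t1).
  { change (Rabs (t1 - 0) < d); rewrite Rabs_pos_eq; lra. }
  specialize (Hd t1 Hb1); change (Rabs (g t1 - g 0) < g 0 - 1) in Hd.
  apply Rabs_lt_between in Hd; lra. }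
destruct H1 as [t1 [Ht1 Hgt1]].
destruct (zeta_small sg v Hs ltac:(lra)) as [t2 [Ht2 Hgt2]]; fold (g t2) in Hgt2.
destruct (IVT_gen g t1 t2 v) as [t [Ht Hgt]].
- intros u; apply continuity_pt_filterlim, Hg.
- rewrite Rmin_right, Rmax_left; lra.
- rewrite Rmin_left, Rmax_right in Ht by lra.
  exists (sg, t); simpl; unfold sg in *; repeat split; try lra; exact Hgt.
Qed.

(** * Jacob's ladders *)

Lemma Rprod_S (m n : nat) (g : nat -> R) : Rprod m (S n) g = Rprod m n g * g (m + n)%nat.
Proof.
unfold Rprod; rewrite seq_S, map_app; simpl.
induction (map g (seq m n)) as [|x l IH]; simpl; [ring|rewrite IH; ring].
Qed.

Lemma Rprod_div (m n : nat) (g h : nat -> R) :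
  Rprod m n (fun r => g r / h r) = Rprod m n g / Rprod m n h.
Proof.
induction n as [|n IH]; [unfold Rprod; simpl; field|].
rewrite !Rprod_S, IH; unfold Rdiv; rewrite Rinv_mult; ring.
Qed.

(** Along the ladder r = 1, ..., k belongs to the iterate of order k - r, whereas [F0] multiplies
    over the orders 0, ..., k - 1. *)
Lemma Rprod_rev (k : nat) (g : nat -> R) : Rprod 1 k (fun r => g (k - r)%nat) = Rprod 0 k g.
Proof.
induction k as [|k IH]; [reflexivity|].
rewrite (Rprod_S 0), <- IH; unfold Rprod; cbn [seq map fold_right].
rewrite Rmult_comm; f_equal.
- rewrite <- (seq_shift k 1), map_map; reflexivity.
- f_equal; lia.
Qed.

Section ladder.

Variables (mu : R -> R) (y0 T0 : R).
Hypothesis hadm : admissible mu y0 T0.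
Let ladder := phi1 mu y0.

Lemma ladder_increasing (s t : R) : T0 < s -> s < t -> ladder s < ladder t.
Proof. intros Hs Hst; now apply hadm. Qed.

Lemma ladder_continuous (t : R) : T0 < t -> continuous ladder t.
Proof. intros Ht; apply (ex_derive_continuous ladder); now apply hadm. Qed.

(** [iota] is meaningful here: existence comes from unboundedness and the intermediate value
    theorem, uniqueness from strict monotonicity beyond [T0]. *)
Lemma ladder_preimage (V x : R) : T0 < V -> ladder V < x ->
  let t := iota (fun t => T0 < t /\ ladder t = x) in V < t /\ ladder t = x.
Proof.
intros HV Hx t.
destruct (proj1 (proj2 (proj2 (proj2 hadm))) x) as [t1 [Ht1 Hxt1]]; fold ladder in Hxt1.
assert (HVt1 : V < t1).
{ destruct (Rtotal_order V t1) as [H|[H|H]]; [easy|subst; lra|].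
  pose proof (ladder_increasing t1 V Ht1 H); lra. }
destruct (IVT_interv (fun u => ladder u - x) V t1) as [z [Hz Ez]]; [|lra|lra|lra|].
{ intros u Hu; apply continuity_pt_minus; [|apply continuity_pt_const; now intros ? ?].
  apply continuity_pt_filterlim, ladder_continuous; lra. }
assert (Hs : T0 < t /\ ladder t = x).
{ apply (iota_correct (fun t => T0 < t /\ ladder t = x)); exists z; split; [lra|].
  intros z' [Hz' Ez'].
  destruct (Rtotal_order z z') as [H|[H|H]]; [|easy|].
  - pose proof (ladder_increasing z z' ltac:(lra) H); lra.
  - pose proof (ladder_increasing z' z ltac:(lra) H); lra. }
split; [|apply Hs].
destruct (Rtotal_order V t) as [H|[H|H]]; [easy|subst V; lra|].
pose proof (ladder_increasing t V ltac:(apply Hs) H); lra.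
Qed.

(** The lower bound [V] carries the induction: the next reverse iterate exceeds W as soon as the
    previous one exceeds [ladder W]. *)
Lemma reverse_iterate_spec (k : nat) (V : R) : exists V', forall X, V' < X ->
  forall r, (r <= k)%nat -> V < reverse_iterate mu y0 T0 r X /\
    ((r < k)%nat -> T0 < reverse_iterate mu y0 T0 (S r) X /\
      ladder (reverse_iterate mu y0 T0 (S r) X) = reverse_iterate mu y0 T0 r X).
Proof.
revert V; induction k as [|k IH]; intros V.
- exists V; intros X HX r Hr; replace r with 0%nat by lia; split; [exact HX|lia].
- set (W := Rmax V (T0 + 1)).
  assert (HW : V <= W /\ T0 + 1 <= W) by (split; [apply Rmax_l|apply Rmax_r]).
  destruct (IH (Rmax V (ladder W))) as [V' HV'].
  exists V'; intros X HX.
  assert (K : W < reverse_iterate mu y0 T0 (S k) X /\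
    ladder (reverse_iterate mu y0 T0 (S k) X) = reverse_iterate mu y0 T0 k X).
  { apply (ladder_preimage W); [lra|].
    eapply Rle_lt_trans; [apply Rmax_r|]; apply (proj1 (HV' X HX k (le_n k))). }
  intros r Hr; destruct (Nat.eq_dec r (S k)) as [->|Hne]; [split; [lra|lia]|].
  destruct (HV' X HX r ltac:(lia)) as [H1 H2].
  split; [eapply Rle_lt_trans; [apply Rmax_l|exact H1]|].
  intros _; destruct (Nat.eq_dec r k) as [->|Hne']; [|apply H2; lia].
  split; [lra|apply K].
Qed.

(* [X] is so large that the reverse iterates of order at most [k] are well defined. *)
Definition reversible (k : nat) (X : R) : Prop :=
  forall r, (r < k)%nat -> T0 < reverse_iterate mu y0 T0 (S r) X /\
      ladder (reverse_iterate mu y0 T0 (S r) X) = reverse_iterate mu y0 T0 r X.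

Variables (k : nat) (X Y : R).
Hypotheses (hX : reversible k X) (hY : reversible k Y) (hXY : X < Y).

Let lo r := reverse_iterate mu y0 T0 r X.
Let hi r := reverse_iterate mu y0 T0 r Y.

Lemma reverse_iterate_lt (r : nat) : (r <= k)%nat -> lo r < hi r.
Proof.
induction r as [|r IH]; intros Hr; [exact hXY|].
destruct (hX r Hr) as [X1 X2]; destruct (hY r Hr) as [Y1 Y2].
specialize (IH ltac:(lia)); fold (lo (S r)) (lo r) in X1, X2; fold (hi (S r)) (hi r) in Y1, Y2.
destruct (Rtotal_order (lo (S r)) (hi (S r))) as [H|[H|H]]; [easy|rewrite H in X2; lra|].
pose proof (ladder_increasing _ _ Y1 H); lra.
Qed.

Lemma iterate_bounds (r : nat) (t : R) : (r <= k)%nat -> lo k <= t <= hi k ->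
  lo (k - r) <= iterate mu y0 r t <= hi (k - r).
Proof.
intros Hr Ht; induction r as [|r IH]; [rewrite Nat.sub_0_r; exact Ht|].
specialize (IH ltac:(lia)).
destruct (hX (k - S r)%nat ltac:(lia)) as [X1 X2]; destruct (hY (k - S r)%nat ltac:(lia)) as [Y1 Y2].
replace (S (k - S r)) with (k - r)%nat in * by lia.
fold (lo (k - r)) (lo (k - S r)) in X1, X2; fold (hi (k - r)) (hi (k - S r)) in Y1, Y2.
change (iterate mu y0 (S r) t) with (ladder (iterate mu y0 r t)).
set (u := iterate mu y0 r t) in *; rewrite <- X2, <- Y2; split.
- destruct (Req_dec (lo (k - r)) u) as [->|Hne]; [lra|].
  apply Rlt_le, ladder_increasing; lra.
- destruct (Req_dec u (hi (k - r))) as [->|Hne]; [lra|].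
  apply Rlt_le, ladder_increasing; lra.
Qed.

Lemma iterate_gt (r : nat) (t : R) : (r < k)%nat -> lo k <= t <= hi k ->
  T0 < iterate mu y0 r t.
Proof.
intros Hr Ht; pose proof (iterate_bounds r t ltac:(lia) Ht) as H.
destruct (hX (k - S r)%nat ltac:(lia)) as [X1 _].
replace (S (k - S r)) with (k - r)%nat in X1 by lia; fold (lo (k - r)) in X1; lra.
Qed.

Lemma iterate_reverse_iterate (r : nat) (Z : R) : reversible k Z -> (r <= k)%nat ->
  iterate mu y0 r (reverse_iterate mu y0 T0 k Z) = reverse_iterate mu y0 T0 (k - r) Z.
Proof.
intros HZ; induction r as [|r IH]; intros Hr; [now rewrite Nat.sub_0_r|].
change (iterate mu y0 (S r) (reverse_iterate mu y0 T0 k Z))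
  with (ladder (iterate mu y0 r (reverse_iterate mu y0 T0 k Z))).
rewrite IH by lia; destruct (HZ (k - S r)%nat ltac:(lia)) as [_ H].
now replace (S (k - S r)) with (k - r)%nat in H by lia.
Qed.

(** By the chain rule [F0] is the Jacobian of the iterated ladder, which is why products of
    [Ztilde2] along an orbit appear. *)
Lemma is_derive_iterate (r : nat) (t : R) : (r <= k)%nat -> lo k <= t <= hi k ->
  is_derive (iterate mu y0 r) t (F0 mu y0 r t).
Proof.
intros Hr Ht; induction r as [|r IH].
- apply (is_derive_ext (fun t => t)); [reflexivity|].
  replace (F0 mu y0 0 t) with 1 by reflexivity; auto_derive; [easy|ring].
- unfold F0; rewrite Rprod_S; fold (F0 mu y0 r t).
  apply (is_derive_ext (fun t => ladder (iterate mu y0 r t))); [reflexivity|].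
  apply (is_derive_comp ladder); [|apply IH; lia].
  apply Derive_correct, hadm, iterate_gt; [lia|exact Ht].
Qed.

Lemma continuous_F0 (r : nat) (t : R) : (r <= k)%nat -> lo k <= t <= hi k ->
  continuous (F0 mu y0 r) t.
Proof.
intros Hr Ht; induction r as [|r IH].
- apply continuous_ext with (fun _ => 1); [reflexivity|apply continuous_const].
- apply continuous_ext
    with (fun u => F0 mu y0 r u * Ztilde2 mu y0 (iterate mu y0 r u)).
  { intros u; unfold F0; now rewrite Rprod_S. }
  apply (continuous_mult (F0 mu y0 r)); [apply IH; lia|].
  apply (continuous_comp (iterate mu y0 r) (Ztilde2 mu y0)).
  + apply (ex_derive_continuous (iterate mu y0 r)).
    eexists; apply is_derive_iterate; [lia|exact Ht].
  + apply hadm, iterate_gt; [lia|exact Ht].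
Qed.

Lemma RInt_ladder (G f : R -> R) :
  (forall x, is_derive G x (f x)) -> (forall x, continuous f x) ->
  RInt (F mu y0 f k) (lo k) (hi k) = G Y - G X.
Proof.
intros HG Hf; apply is_RInt_unique.
pose proof (reverse_iterate_lt k (le_n k)) as Hlt.
assert (E : forall Z, reversible k Z -> iterate mu y0 k (reverse_iterate mu y0 T0 k Z) = Z).
{ intros Z HZ; rewrite iterate_reverse_iterate, Nat.sub_diag by easy; reflexivity. }
rewrite <- (E Y hY), <- (E X hX) at 1; fold (lo k) (hi k).
apply (is_RInt_derive (fun t => G (iterate mu y0 k t))).
- rewrite Rmin_left, Rmax_right by lra; intros t Ht.
  unfold F; rewrite Rmult_comm.
  apply (is_derive_comp G); [apply HG|now apply is_derive_iterate].
- rewrite Rmin_left, Rmax_right by lra; intros t Ht.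
  apply (continuous_mult (fun t => f (iterate mu y0 k t)) (F0 mu y0 k));
    [|now apply continuous_F0].
  apply (continuous_comp (iterate mu y0 k) f); [|apply Hf].
  apply (ex_derive_continuous (iterate mu y0 k)); eexists; now apply is_derive_iterate.
Qed.

Lemma RInt_ladder_F0 : RInt (F0 mu y0 k) (lo k) (hi k) = Y - X.
Proof.
rewrite <- (RInt_ladder (fun x => x) (fun _ => 1)).
- apply RInt_ext; intros t _; unfold F; now rewrite Rmult_1_l.
- intros x; auto_derive; [easy|ring].
- intros x; apply continuous_const.
Qed.

(** Both mean values carry the same length of the interval of reverse iterates, so this unknown
    length cancels in the quotient. *)
Lemma mean_value_ratio (G f : R -> R) (d e : R) :
  (forall x, is_derive G x (f x)) -> (forall x, continuous f x) ->
  mean_value_point (F mu y0 f k) (lo k) (hi k) d ->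
  mean_value_point (F0 mu y0 k) (lo k) (hi k) e ->
  F0 mu y0 k d / F0 mu y0 k e * f (iterate mu y0 k d) = (G Y - G X) / (Y - X).
Proof.
intros HG Hf [_ Hd] [_ He].
rewrite (RInt_ladder G f HG Hf) in Hd; rewrite RInt_ladder_F0 in He.
pose proof (reverse_iterate_lt k (le_n k)) as Hlt.
rewrite He; unfold Rdiv; rewrite Rmult_assoc, (Rmult_comm (/ _)), <- Rmult_assoc.
unfold F in Hd; rewrite (Rmult_comm (F0 mu y0 k d)), Hd; field; lra.
Qed.

End ladder.

(** * The two means, the choice of the points w, and the conclusion *)

Lemma is_derive_sin_sqr_primitive (x : R) :
  is_derive (fun x => x / 2 - sin (2 * x) / 4) x (f1 x).
Proof.
unfold f1; auto_derive; [easy|].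
rewrite cos_2a_sin; field.
Qed.

Lemma is_derive_cos_sqr_primitive (x : R) :
  is_derive (fun x => x / 2 + sin (2 * x) / 4) x (f2 x).
Proof.
unfold f2; auto_derive; [easy|].
rewrite cos_2a_cos; field.
Qed.

(** Hilbert's epsilon turns mere existence into a function of the listed parameters, defined before
    the strips and the threshold. For the mean-value choice [alpha], the k-th iterate of
    [alpha U X k] is the point alpha_0. *)
Definition zeta_point (alpha : R -> R -> nat -> R) (mu : R -> R) (y0 : R)
    (U X : R) (k : nat) (f : R -> R) (a b : R) : C :=
  epsilon (inhabits (RtoC 0)) (fun w => a < Re w < b /\ 0 < Im w /\
    Cmod (zeta w) = f (iterate mu y0 k (alpha U X k))).

Lemma zeta_point_spec (alpha : R -> R -> nat -> R) (mu : R -> R) (y0 U X : R) (k : nat)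
    (f : R -> R) (a b : R) : 1 / 2 < a -> a < b -> b < 1 ->
  0 < f (iterate mu y0 k (alpha U X k)) <= 1 ->
  let w := zeta_point alpha mu y0 U X k f a b in
  a < Re w < b /\ 0 < Im w /\ Cmod (zeta w) = f (iterate mu y0 k (alpha U X k)).
Proof.
intros Ha Hab Hb Hv; unfold zeta_point.
apply (epsilon_spec (inhabits (RtoC 0)) (fun w => a < Re w < b /\ 0 < Im w /\
    Cmod (zeta w) = f (iterate mu y0 k (alpha U X k)))).
now apply zeta_modulus_value.
Qed.

Lemma Rprod_ladder_points (mu : R -> R) (y0 : R) (d e : R -> R -> nat -> R)
    (U X : R) (k : nat) :
  Rprod 1 k (fun r => Ztilde2 mu y0 (ladder_point mu y0 d U X k r)
                      / Ztilde2 mu y0 (ladder_point mu y0 e U X k r))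
  = F0 mu y0 k (d U X k) / F0 mu y0 k (e U X k).
Proof.
rewrite (Rprod_div 1 k (fun r => Ztilde2 mu y0 (ladder_point mu y0 d U X k r))).
f_equal; [|f_equal].
- exact (Rprod_rev k (fun r => Ztilde2 mu y0 (iterate mu y0 r (d U X k)))).
- exact (Rprod_rev k (fun r => Ztilde2 mu y0 (iterate mu y0 r (e U X k)))).
Qed.

Lemma increasing_between (U : nat -> R) (n0 n : nat) :
  (forall n, (1 <= n)%nat -> (n < n0)%nat -> U n < U (S n)) -> (1 <= n <= n0)%nat ->
  U 1%nat <= U n <= U n0.
Proof.
intros H [Hn Hn0].
assert (K : forall i j, (1 <= i)%nat -> (i <= j)%nat -> (j <= n0)%nat -> U i <= U j).
{ intros i j Hi Hij; induction Hij as [|j Hij IH]; intros Hj; [lra|].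
  pose proof (IH ltac:(lia)); pose proof (H j ltac:(lia) ltac:(lia)); lra. }
split; apply K; lia.
Qed.

Theorem theorem2 (k0 : nat) (hk0 : (1 <= k0)%nat)
    (mu : R -> R) (y0 T0 : R)
    (hmu : ladder_parameter mu y0) (hadm : admissible mu y0 T0)
    (d1 d2 e : R -> R -> nat -> R)
    (hd1 : mean_value_choice mu y0 T0 k0 (F mu y0 f1) d1)
    (hd2 : mean_value_choice mu y0 T0 k0 (F mu y0 f2) d2)
    (he : mean_value_choice mu y0 T0 k0 (F0 mu y0) e) :
  exists w1 w2 : R -> R -> nat -> (R -> R) -> R -> R -> C,
  forall s1 s01 s02 s03 s2 delta : R,
    1 / 2 < s1 -> s1 < s01 -> s01 < s02 -> s02 < s03 -> s03 < s2 -> s2 < 1 ->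
    0 < delta ->
    s1 < s01 - delta -> s03 + delta < s2 ->
    s01 + delta < s02 - delta -> s02 + delta < s03 - delta ->
  exists L0 : R, 0 < L0 /\
  forall (n0 : nat) (U : nat -> R),
    (1 <= n0)%nat ->
    0 < U 1%nat ->
    (forall n : nat, (1 <= n)%nat -> (n < n0)%nat -> U n < U (S n)) ->
    U n0 < PI / 4 ->
  forall L : nat, L0 <= INR L ->
  forall k1 k2 : nat, (1 <= k1 <= k0)%nat -> (1 <= k2 <= k0)%nat ->
  forall n : nat, (1 <= n <= n0)%nat ->
    let X := PI * INR L in
    let w1n := w1 (U n) X k1 f1 (s01 - delta) (s01 + delta) in
    let w2n := w2 (U n) X k2 f2 (s02 - delta) (s02 + delta) in
    in_strip s01 delta w1n /\ in_strip s02 delta w2n /\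
    Rprod 1 k1 (fun r =>
        Ztilde2 mu y0 (ladder_point mu y0 d1 (U n) X k1 r)
        / Ztilde2 mu y0 (ladder_point mu y0 e (U n) X k1 r))
      * Cmod (zeta w1n)
    + Rprod 1 k2 (fun r =>
        Ztilde2 mu y0 (ladder_point mu y0 d2 (U n) X k2 r)
        / Ztilde2 mu y0 (ladder_point mu y0 e (U n) X k2 r))
      * Cmod (zeta w2n) = 1.
Proof.
exists (zeta_point d1 mu y0), (zeta_point d2 mu y0).
intros s1 s01 s02 s03 s2 delta Hs1 Hs2 Hs3 Hs4 Hs5 Hs6 Hd Hd1 Hd2 Hd3 Hd4.
destruct (reverse_iterate_spec mu y0 T0 hadm k0 0) as [V HV].
destruct hd1 as [L1 H1]; destruct hd2 as [L2 H2]; destruct he as [L3 H3].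
destruct (nfloor_ex (Rmax V 0) (Rmax_r V 0)) as [m [_ Hm]].
(* This dominates the three mean-value thresholds and, since m + 1 > V and PI >= 1, forces X > V;
   neither [U] nor [k1], [k2] enters. *)
exists (INR (L1 + L2 + L3 + S m)); split; [apply lt_0_INR; lia|].
intros n0 U Hn0 HU1 HUinc HUn0 L HL k1 k2 Hk1 Hk2 n Hn X w1n w2n.
apply INR_le in HL.
assert (HUn : 0 < U n < PI / 4) by (pose proof (increasing_between U n0 n HUinc Hn); lra).
set (u := U n) in *.
assert (HX : V < X).
{ apply Rle_lt_trans with (Rmax V 0); [apply Rmax_l|].
  apply Rlt_le_trans with (INR m + 1); [exact Hm|].
  rewrite <- S_INR; apply Rle_trans with (1 * INR L).
  - rewrite Rmult_1_l; apply le_INR; lia.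
  - apply Rmult_le_compat_r; [apply pos_INR|]; pose proof PI2_1; lra. }
assert (HR : forall k Z, (1 <= k <= k0)%nat -> V < Z -> reversible mu y0 T0 k Z).
{ intros k Z Hk HZ r Hr; apply (HV Z HZ r); lia. }
specialize (H1 u L k1 HUn ltac:(lia) Hk1); fold X in H1.
specialize (H2 u L k2 HUn ltac:(lia) Hk2); fold X in H2.
pose proof (H3 u L k1 HUn ltac:(lia) Hk1) as He1; fold X in He1.
pose proof (H3 u L k2 HUn ltac:(lia) Hk2) as He2; fold X in He2.
pose proof (mean_value_ratio mu y0 T0 hadm k1 X (X + u) (HR k1 X Hk1 HX)
  (HR k1 (X + u) Hk1 ltac:(lra)) ltac:(lra) _ f1 _ _ is_derive_sin_sqr_primitive
  (fun x => ex_derive_continuous f1 x ltac:(unfold f1; auto_derive; easy)) H1 He1) as R1.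
pose proof (mean_value_ratio mu y0 T0 hadm k2 X (X + u) (HR k2 X Hk2 HX)
  (HR k2 (X + u) Hk2 ltac:(lra)) ltac:(lra) _ f2 _ _ is_derive_cos_sqr_primitive
  (fun x => ex_derive_continuous f2 x ltac:(unfold f2; auto_derive; easy)) H2 He2) as R2.
(* X is a multiple of PI, so periodicity reduces the two means to 1/2 - sin (2u)/(4u) and 1/2 + sin
   (2u)/(4u). *)
assert (HsX : sin (2 * (X + u)) = sin (2 * u) /\ sin (2 * X) = 0).
{ split.
  - rewrite <- (sin_period (2 * u) L); f_equal; unfold X; ring.
  - rewrite <- sin_0, <- (sin_period 0 L); f_equal; unfold X; ring. }
destruct HsX as [S1 S2]; cbv beta in R1, R2; rewrite S1, S2 in R1, R2.
pose proof (sin_lt_x (2 * u) ltac:(lra)) as Su.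
pose proof (sin_gt_0 (2 * u) ltac:(lra) ltac:(lra)) as Su'.
replace (X + u - X) with u in R1, R2 by ring.
(* A zero value would make the mean of sin^2 vanish, but that mean is positive because sin (2u) <
   2u. *)
assert (V1 : 0 < f1 (iterate mu y0 k1 (d1 u X k1)) <= 1).
{ assert (N1 : f1 (iterate mu y0 k1 (d1 u X k1)) <> 0).
  { intros E; rewrite E, Rmult_0_r in R1.
    assert (0 < ((X + u) / 2 - sin (2 * u) / 4 - (X / 2 - 0 / 4)) / u)
      by (apply Rdiv_lt_0_compat; lra).
    lra. }
  revert N1; unfold f1; intros N1.
  pose proof (pow2_ge_0 (sin (iterate mu y0 k1 (d1 u X k1)))).
  pose proof (SIN_bound (iterate mu y0 k1 (d1 u X k1))).
  split; [lra|nra]. }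
(* The mean of cos^2 even exceeds 1/2, since 0 < 2u < PI/2 gives sin (2u) > 0. *)
assert (V2 : 0 < f2 (iterate mu y0 k2 (d2 u X k2)) <= 1).
{ assert (N2 : f2 (iterate mu y0 k2 (d2 u X k2)) <> 0).
  { intros E; rewrite E, Rmult_0_r in R2.
    assert (0 < ((X + u) / 2 + sin (2 * u) / 4 - (X / 2 + 0 / 4)) / u)
      by (apply Rdiv_lt_0_compat; lra).
    lra. }
  revert N2; unfold f2; intros N2.
  pose proof (pow2_ge_0 (cos (iterate mu y0 k2 (d2 u X k2)))).
  pose proof (COS_bound (iterate mu y0 k2 (d2 u X k2))).
  split; [lra|nra]. }
destruct (zeta_point_spec d1 mu y0 u X k1 f1 (s01 - delta) (s01 + delta)
  ltac:(lra) ltac:(lra) ltac:(lra) V1) as [W1 [W1' Z1]]; fold w1n in W1, W1', Z1.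
destruct (zeta_point_spec d2 mu y0 u X k2 f2 (s02 - delta) (s02 + delta)
  ltac:(lra) ltac:(lra) ltac:(lra) V2) as [W2 [W2' Z2]]; fold w2n in W2, W2', Z2.
split; [now split|split; [now split|]].
rewrite Z1, Z2, !Rprod_ladder_points, R1, R2; field; lra.
Qed.
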